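(* Suppose that $l_i,\lambda_i,f_i,G_i,H_i$ ($i=1,\dots,n$) and $\varphi$ are all $C^1$ functions of their arguments, and that $\frac{\partial G_i}{\partial t}(t,\cdot)$ ($i=1,\dots,n$) satisfy local Lipschitz conditions with respect to the variable $v=(v_1,\dots,v_n)^T$. Suppose furthermore that $f_i(0)=0$ ($i=1,\dots,n$), that $\lambda_r(u)<0<\lambda_s(u)$ for $r=1,\dots,m$, $s=m+1,\dots,n$, that $G_i(t,0,\dots,0)\equiv 0$ ($i=1,\dots,n$), and that $$T>L\max_{i=1,\dots,n}\frac{1}{|\lambda_i(0)|}.$$ Suppose finally that $\|\varphi\|_{C^1[0,L]}$ and $\|H_i\|_{C^1[0,T]}$ ($i=1,\dots,n$) are sufficiently small, and that the conditions of $C^1$ compatibility at the points $(t,x)=(0,0)$ and $(0,L)$ are satisfied for the mixed problem $$l_i(u)\Big(\frac{\partial u}{\partial t}+\lambda_i(u)\frac{\partial u}{\partial x}\Big)=f_i(u)\quad (i=1,\dots,n),\qquad u(0,x)=\varphi(x),\ x\in[0,L],$$ $$v_s(t,0)=G_s(t,v_1(t,0),\dots,v_m(t,0),v_{m+1}(t,L),\dots,v_n(t,L))+H_s(t)\quad (s=m+1,\dots,n),$$ $$v_r(t,L)=G_r(t,v_1(t,0),\dots,v_m(t,0),v_{m+1}(t,L),\dots,v_n(t,L))+H_r(t)\quad (r=1,\dots,m),$$ where $v_i=l_i(u)u$. Let $u=u(t,x)$ be its $C^1$ solution with small $C^1$ norm on $\{(t,x)\mid 0\le t\le T,\ 0\le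 x\le L\}$. Then the initial data $\varphi$ can be uniquely determined by the boundary observations $\overline v_r(t):=v_r(t,0)$ ($r=1,\dots,m$) and $\overline{\overline v}_s(t):=v_s(t,L)$ ($s=m+1,\dots,n$), $t\in[0,T]$, together with the known boundary functions $H_i(t)$ ($i=1,\dots,n$). Moreover, the following observability estimate holds: $$\|\varphi\|_{C^1[0,L]}\le C\Big(\sum_{r=1}^{m}\|\overline v_r\|_{C^1[0,T]}+\sum_{s=m+1}^{n}\|\overline{\overline v}_s\|_{C^1[0,T]}+\sum_{i=1}^{n}\|H_i\|_{C^1[0,T]}\Big),$$ where $C$ is a positive constant possibly depending on $T$ (but not on $\varphi$, $H_i$).
   Context: Consider the first order quasilinear hyperbolic system $\frac{\partial u}{\partial t}+A(u)\frac{\partial u}{\partial x}=B(u)$ for $u=(u_1,\dots,u_n)^T$, a function of $(t,x)$, where $A(u)$ is an $n\times n$ matrix and $B(u)$ is a vector function with $B(0)=0$. The domain under consideration is a neighbourhood of $u=0$ in $\mathbb{R}^n$ (with $x\in[0,L]$, $L>0$). Hyperbolicity: for each $u$ in this domain $A(u)$ has $n$ real eigenvalues $\lambda_1(u),\dots,\lambda_n(u)$ and a complete (linearly independent) set of left eigenvectors $l_i(u)=(l_{i1}(u),\dots,l_{in}(u))$, $l_i(u)A(u)=\lambda_i(u)l_i(u)$. Put $f_i(u)=l_i(u)B(u)$. Here $0\le m\le n$ and there are no zero eigenvalues. The variable $v=(v_1,\dots,v_n)^T$ of $G_i(t,\cdot)$ denotes its $n$ arguments other than $t$. The conditions of $C^1$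 compatibility mean that the boundary conditions, and their first derivatives with respect to $t$, hold at $t=0$ when $u(0,x)$ is replaced by $\varphi(x)$ and $u_t(0,x)$ by $-A(\varphi(x))\varphi'(x)+B(\varphi(x))$. ''Sufficiently small'' means bounded by some $\varepsilon>0$ possibly depending on $T$; under these smallness and compatibility conditions the mixed problem has a unique $C^1$ solution with small $C^1$ norm on $[0,T]\times[0,L]$. ''Uniquely determined'' means that two admissible initial data whose solutions (with the same $H_i$) give the same boundary observations on $[0,T]$ coincide. *)

(* Defs.v *)
From mathcomp Require Export all_boot all_order all_algebra.
From mathcomp Require Export all_classical all_reals all_analysis.
Export Order.TTheory GRing.Theory Num.Theory.
Export numFieldNormedType.Exports.

Set Implicit Arguments.
Unset Strict Implicit.
Unset Printing Implicit Defensive.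

Local Open Scope classical_set_scope.
Local Open Scope ring_scope.

(* 'D_v is a two-sided limit, hence unsuitable on a compact interval: the    *)
(* derivatives below become one-sided at the endpoints.                      *)

Section ClosedC1.
Context {R : realType} {W : normedModType R}.
Implicit Types (I J : set R) (f : R -> W) (u : R -> R -> W).

Definition quotient_within I f (x : R) : set_system W :=
  (fun h => h^-1 *: (f (x + h) - f x)) @
    within [set h | I (x + h)] (0 : R)^'.

Definition derivable_within I f x := cvg (quotient_within I f x).

Definition derive_within I f x : W := lim (quotient_within I f x).

Definition C1_within I f :=
  (forall x, I x -> derivable_within I f x) /\
  {within I, continuous (derive_within I f)}.

Definition sup_norm {E : Type} (D : set E) (g : E -> W) : R :=
  sup [set `|g p| | p in D].

Definition C1_norm I f : R := sup_norm I f + sup_norm I (derive_within I f).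

(* For a function u(t, x) on the rectangle I x J. *)
Definition dt I u (t x : R) : W := derive_within I (u ^~ x) t.
Definition dx J u (t x : R) : W := derive_within J (u t) x.

Definition C1_rect I J u :=
  [/\ forall t x, I t -> J x -> derivable_within I (u ^~ x) t,
      forall t x, I t -> J x -> derivable_within J (u t) x,
      {within I `*` J, continuous (fun p : R * R => u p.1 p.2)},
      {within I `*` J, continuous (fun p : R * R => dt I u p.1 p.2)} &
      {within I `*` J, continuous (fun p : R * R => dx J u p.1 p.2)}].

Definition C1_rect_norm I J u : R :=
  sup_norm (I `*` J) (fun p => u p.1 p.2) +
  sup_norm (I `*` J) (fun p => dt I u p.1 p.2) +
  sup_norm (I `*` J) (fun p => dx J u p.1 p.2).

End ClosedC1.

Definition C1_open {R : realType} {V W : normedModType R} (U : set V)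
    (f : V -> W) :=
  (forall a, U a -> differentiable f a) /\
  (forall v, {within U, continuous ('D_v f)}).

(* g(t, v) is C^1 on I x V, with I a compact interval and V open. *)
Definition C1_time_open {R : realType} {E W : normedModType R}
    (I : set R) (V : set E) (g : R -> E -> W) :=
  [/\ forall t v, I t -> V v -> derivable_within I (g ^~ v) t,
      forall t v, I t -> V v -> differentiable (g t) v,
      {within I `*` V, continuous (fun p : R * E => g p.1 p.2)},
      {within I `*` V, continuous
         (fun p : R * E => derive_within I (g ^~ p.2) p.1)} &
      forall w, {within I `*` V, continuous
         (fun p : R * E => 'D_w (g p.1) p.2)}].

(* g(t, v) is locally Lipschitz in v, with a Lipschitz constant that is      *)
(* locally uniform in t.                                                     *)
Definition locally_lipschitz_snd {R : realType} {E W : normedModType R}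
    (I : set R) (V : set E) (g : R -> E -> W) :=
  forall t0 v0, I t0 -> V v0 ->
  exists K : R, exists2 N : set (R * E), nbhs (t0, v0) N &
    forall t, I t -> K.-lipschitz_[set v | V v /\ N (t, v)] (g t).

Section MixedProblem.
Context {R : realType} {n : nat}.
Implicit Types (m : nat) (L T : R) (U V : set 'cV[R]_n).
Implicit Types (A : 'cV[R]_n -> 'M[R]_n) (B : 'cV[R]_n -> 'cV[R]_n).
Implicit Types (l : 'I_n -> 'cV[R]_n -> 'rV[R]_n).
Implicit Types (lambda : 'I_n -> 'cV[R]_n -> R).
Implicit Types (G : 'I_n -> R -> 'cV[R]_n -> R) (H : 'I_n -> R -> R).
Implicit Types (phi : R -> 'cV[R]_n) (u : R -> R -> 'cV[R]_n).

Definition hyperbolic U A l lambda :=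
  forall a, U a ->
    row_free (\matrix_(i < n) l i a) /\
    (forall i, l i a *m A a = lambda i a *: l i a).

Definition source B l (i : 'I_n) (a : 'cV[R]_n) : R := (l i a *m B a) 0 0.

Definition char_var l (i : 'I_n) (a : 'cV[R]_n) : R := (l i a *m a) 0 0.

(* Indices are shifted by one: 1..m and m+1..n become i < m and m <= i < n.  *)
(* The i-th characteristic leaves [0, L] through x_out (the end where v_i is *)
(* observed) and enters it through x_in (where v_i is prescribed).           *)
Definition x_out m L (i : 'I_n) : R := if (i < m)%N then 0 else L.
Definition x_in m L (i : 'I_n) : R := if (i < m)%N then L else 0.

(* The vector (v_1(.,0),...,v_m(.,0),v_{m+1}(.,L),...,v_n(.,L)) computed     *)
(* from a state w : x |-> w(x).                                              *)
Definition outgoing m L l (w : R -> 'cV[R]_n) : 'cV[R]_n :=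
  \col_i char_var l i (w (x_out m L i)).

Definition C1_solution m L T U V B l lambda G H phi u :=
  [/\ C1_rect `[0, T] `[0, L] u,
      (forall t x, t \in `[0, T] -> x \in `[0, L] -> U (u t x)) /\
      (forall t, t \in `[0, T] -> V (outgoing m L l (u t))),
      forall i t x, t \in `[0, T] -> x \in `[0, L] ->
        (l i (u t x) *m (dt `[0, T] u t x
           + lambda i (u t x) *: dx `[0, L] u t x)) 0 0
        = source B l i (u t x),
      forall x, x \in `[0, L] -> u 0 x = phi x &
      forall i t, t \in `[0, T] ->
        char_var l i (u t (x_in m L i))
        = G i t (outgoing m L l (u t)) + H i t].

(* The value of u_t(0, x) dictated by the system and u(0, .) = phi. *)
Definition initial_velocity L A B phi (x : R) : 'cV[R]_n :=
  - (A (phi x) *m derive_within `[0, L] phi x) + B (phi x).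

(* The induced value of (d/dt) v_i(0, x), where v_i = l_i(u) u. *)
Definition initial_char_velocity L A B l phi (i : 'I_n) (x : R) : R :=
  'D_(initial_velocity L A B phi x) (char_var l i) (phi x).

(* The t-derivative of G_i(t, w(t)) is expanded by the chain rule. *)
Definition C1_compatible m L T A B l G H phi :=
  let w := outgoing m L l phi in
  let w' := \col_j initial_char_velocity L A B l phi j (x_out m L j) in
  forall i,
    char_var l i (phi (x_in m L i)) = G i 0 w + H i 0 /\
    initial_char_velocity L A B l phi i (x_in m L i)
    = derive_within `[0, T] (G i ^~ w) 0 + 'D_w' (G i 0) w
      + derive_within `[0, T] (H i) 0.

Definition admissible_data m L T A B l G (eps : R) H phi :=
  [/\ C1_within `[0, L] phi,
      forall i, C1_within `[0, T] (H i),
      C1_norm `[0, L] phi <= eps,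
      forall i, C1_norm `[0, T] (H i) <= eps &
      C1_compatible m L T A B l G H phi].

(* vbar_r(t) = v_r(t, 0) for r <= m and vbarbar_s(t) = v_s(t, L) for s > m.  *)
Definition observation m L l u (i : 'I_n) (t : R) : R :=
  char_var l i (u t (x_out m L i)).

End MixedProblem.

(* Main.v *)
Require Import Defs.
From mathcomp Require Import all_boot all_order all_algebra.
From mathcomp Require Import all_classical all_reals all_analysis.
From mathcomp Require Import ring lra.

(** The observations and the boundary conditions together prescribe all the
    characteristic coordinates v_i = l_i(u) u, hence u itself, at both ends
    x = 0 and x = L during the whole time interval. Everything follows from one
    stability estimate for the difference w of two small solutions: if
    |w| <= M at both ends on [0, T'], with T' >= mu * L for a slope
    mu > max 1 / |lambda_i(0)|, then |w| <= C M at time 0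
    ([backward_estimate]).

    The theorem is this estimate applied to three pairs of solutions. For u and
    0 it bounds u(0, x). For u and its time shift u(t + h, x), on
    [0, T - h], it bounds the increment of u in time by a multiple of h, hence
    u_t(0, x); the boundary values are small with h because the observations
    and the H_i are Lipschitz with constants given by their C1 norms, and
    because G_i(t, .) vanishes at 0 with a Lipschitz t-derivative
    ([boundary_increment]). Then u_x(0, x) is read off the system, whose speeds
    do not vanish ([initial_data_estimate]). For two solutions with the same
    observations and the same H_i the boundary values of w are 0, and the
    initial data coincide ([initial_data_unique]). Differentiating the system,
    whose coefficients are only C1, is thereby avoided.

    The stability estimate does not integrate along characteristic curves
    either. The components z_i = l_i(u) w change at a rate O(|w|) in the
    direction (1, lambda_i(u)) ([char_increment]), and a maximum principle
    suffices: if a compact region allows, from each of its points outside the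
    part where w is already bounded, a move in each characteristic direction,
    forwards or backwards, along which a weight p increases at unit rate, then a
    maximum of exp(kappa p) max_i |z_i| with kappa large can only lie in that
    part ([max_principle], [weighted_propagation]). It is used with x as the
    evolution variable in the two regions bounded by lines of slope mu issuing
    from the ends ([lateral_propagation]); since T' >= mu * L, these regions
    cover the segment t = T' / 2. It is then used with time as the evolution
    variable, backwards from t = T' / 2 to t = 0, where w is bounded at both
    ends for every i.

    Finally, u |-> v is bi-Lipschitz near 0 since the matrix of left
    eigenvectors is invertible there ([char_coords_coercive]), so that bounds on
    the coordinates v_i at the ends are bounds on u. *)

Set Implicit Arguments.
Unset Strict Implicit.
Unset Printing Implicit Defensive.
Import Order.TTheory GRing.Theory Num.Theory.
Local Open Scope classical_set_scope.
Local Open Scope ring_scope.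

(** * One-sided derivatives on a segment *)

Lemma within_continuousP (R : realType) (X W : normedModType R) (A : set X)
    (f : X -> W) :
  {within A, continuous f} <->
  forall x, A x -> forall e, 0 < e ->
    exists2 d, 0 < d & forall y, A y -> `|x - y| < d -> `|f x - f y| <= e.
Proof.
rewrite subspace_continuousP; split=> cf x Ax.
  move=> e e0; move/cvgrPdist_le: (cf x Ax) => /(_ e e0).
  rewrite near_withinE => /nbhs_normP[d /= d0 dP].
  by exists d => // y Ay xy; apply: dP.
apply/cvgrPdist_le => e e0; have [d d0 dP] := cf x Ax e e0.
rewrite near_withinE; apply/nbhs_normP; exists d => //= y /= xy Ay.
exact: dP.
Qed.

Lemma compact_image_bounded (R : realType) (X W : normedModType R) (A : set X)
    (f : X -> W) :
  compact A -> {within A, continuous f} ->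
  exists K, forall x, A x -> `|f x| <= K.
Proof.
move=> cA cf; have /compact_bounded := continuous_compact cf cA.
rewrite /bounded_set /bounded_near /= => -[K [_ KP]].
by exists (K + 1) => x Ax; apply: (KP (K + 1)); [rewrite ltrDl | exists x].
Qed.

(** Compactness of the segment for statements that only get weaker when the
    constant grows; below, c bounds a quantity and c^-1 is the radius of the
    neighbourhood of 0 where the bound is asserted. *)
Lemma segment_uniform (R : realType) (a b : R) (P : R -> R -> Prop) :
  (forall c c' t, 0 < c -> c <= c' -> P c t -> P c' t) ->
  (forall t, t \in `[a, b] -> exists2 d, 0 < d &
     exists2 c, 0 < c & forall s, s \in `[a, b] -> `|t - s| < d -> P c s) ->
  exists2 c, 0 < c & forall t, t \in `[a, b] -> P c t.
Proof.
move=> mP locP.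
have /compact_near_coveringP/(_ R (+oo : set_system R)
  (fun c t => t \in `[a, b] -> P c t)) := @segment_compact R a b.
move=> /(_ _) [].
  move=> t tab; have [d d0 [c c0 cP]] := locP t tab.
  exists (ball t d, [set k | c <= k]).
    by split => /=; [exact: nbhsx_ballx | apply: nbhs_pinfty_ge; rewrite num_real].
  by move=> [s k] /= [ts ck] sab; apply: (@mP c) => //; apply: cP.
move=> k [_ kP]; exists (Num.max (k + 1) 1); first by rewrite lt_max ltr01 orbT.
move=> t tab; apply: kP => //; rewrite lt_max ltrDl ltr01//.
Qed.

(** For a vector-valued g Rolle's theorem is not available, and on a closed
    interval only right derivatives are needed. The real function
    `|g t - g a| - (K + e)(t - a) attains its minimum on [a, b]; the Dini
    condition forbids a minimum at any t < b, so its value at b is at most its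
    value 0 at a. *)
Lemma mean_value_le (R : realType) (W : normedModType R) (g : R -> W)
    (a b K : R) :
  a <= b -> {within `[a, b], continuous g} ->
  (forall t, a <= t < b -> forall e r, 0 < e -> 0 < r ->
     exists2 s, 0 < s < r & t + s <= b /\ `|g (t + s) - g t| <= s * (K + e)) ->
  `|g b - g a| <= K * (b - a).
Proof.
move=> ab cg dini; apply/ler_addgt0Pl => e0 e00.
set e := e0 / (b - a + 1).
have ba0 : 0 < b - a + 1 by rewrite ltr_wpDl ?subr_ge0.
have epos : 0 < e by rewrite divr_gt0.
suff H : `|g b - g a| <= (K + e) * (b - a).
  apply: (le_trans H); rewrite mulrDl addrC lerD2r /e.
  by rewrite mulrAC ler_pdivrMr // ler_pM2l // lerDl.
(* The slack e keeps the comparison strict. *)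
pose F t := `|g t - g a| - (K + e) * (t - a).
have cF : {within `[a, b], continuous F}.
  apply/subspace_continuousP => x xab.
  move/subspace_continuousP: cg => /(_ x xab) cgx.
  apply: cvgB; first by apply: cvg_norm; apply: cvgB => //; exact: cvg_cst.
  apply: cvgM; first exact: cvg_cst.
  by apply: cvgB; [exact: cvg_within | exact: cvg_cst].
have [c /[!in_itv]/= /andP[ac cb] cmin] := EVT_min ab cF.
suff cb' : c = b.
  have := cmin a; rewrite in_itv/= lexx ab => /(_ isT); rewrite cb' /F.
  by rewrite !subrr normr0 mulr0 subr0 subr_le0.
apply/eqP; rewrite eq_le cb /= leNgt; apply/negP => clb.
have cab : a <= c < b by rewrite ac.
have e2 : 0 < e / 2 by rewrite divr_gt0.
have [s /andP[s0 _] [csb gs]] := dini c cab _ _ e2 ltr01.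
have := cmin (c + s); rewrite in_itv/= csb (le_trans ac) ?lerDl ?(ltW s0)//.
move=> /(_ isT); apply/negP; rewrite -ltNge /F.
have tri : `|g (c + s) - g a| <= `|g (c + s) - g c| + `|g c - g a|.
  by rewrite (le_trans _ (ler_normD _ _)) // addrA subrK.
have se : 0 < s * e by rewrite mulr_gt0.
lra.
Qed.

Lemma quotient_withinP (R : realType) (W : normedModType R) (I : set R)
    (f : R -> W) x (l : W) :
  quotient_within I f x --> l <->
  forall e, 0 < e -> exists2 d, 0 < d &
    forall y, I y -> `|x - y| < d ->
      `|f y - f x - (y - x) *: l| <= e * `|y - x|.
Proof.
split=> [/cvgrPdist_le cl e e0|cl].
  have := cl e e0; rewrite near_withinE => /nbhs_normP[d /= d0 dP].
  exists d => // y Iy xy; have [->|yx] := eqVneq y x.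
    by rewrite !subrr scale0r subr0 !normr0 mulr0.
  have h0 : y - x != 0 by rewrite subr_eq0.
  have /(_ _ h0) /= := dP (y - x).
  rewrite sub0r normrN distrC => /(_ xy).
  rewrite addrC subrK => /(_ Iy) H.
  have -> : f y - f x - (y - x) *: l =
    - ((y - x) *: (l - (y - x)^-1 *: (f y - f x))).
    by rewrite scalerBr scalerA divff // scale1r opprB.
  by rewrite normrN normrZ distrC mulrC ler_wpM2r.
apply/cvgrPdist_le => e e0; have [d d0 dP] := cl e e0.
rewrite near_withinE; apply/nbhs_normP; exists d => //= h /=.
rewrite sub0r normrN => hd h0 Ixh.
have := dP (x + h) Ixh.
have -> : x + h - x = h by rewrite addrAC subrr add0r.
rewrite opprD addNKr normrN => /(_ hd) H.
have -> : l - h^-1 *: (f (x + h) - f x) =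
    - (h^-1 *: (f (x + h) - f x - h *: l)).
  by rewrite [in RHS]scalerBr scalerA mulVf // scale1r opprB.
by rewrite normrN normrZ normfV mulrC ler_pdivrMr ?normr_gt0.
Qed.

Lemma derivable_withinE (R : realType) (W : normedModType R) (I : set R)
    (f : R -> W) x e :
  derivable_within I f x -> 0 < e -> exists2 d, 0 < d &
    forall y, I y -> `|x - y| < d ->
      `|f y - f x - (y - x) *: derive_within I f x| <= e * `|y - x|.
Proof. by move=> /quotient_withinP; exact. Qed.

Lemma segment_quotient_proper (R : realType) (a b x : R) :
  a < b -> x \in `[a, b] ->
  ProperFilter (within [set h | `[a, b]%classic (x + h)] (0 : R)^').
Proof.
move=> ab xab; apply: Build_ProperFilter_ex => P.
rewrite /within /= => /nbhs_normP[d /= d0 dP].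
move: xab; rewrite in_itv/= => /andP[ax xb].
have [xb'|bx] := boolP (x < b).
  exists (Num.min (d / 2) (b - x)).
  set h := Num.min _ _.
  have h0 : 0 < h by rewrite lt_min divr_gt0 // subr_gt0.
  have hd : h < d by rewrite gt_min ltr_pdivrMr // ltr_pMr // ltr1n.
  have hb : h <= b - x by rewrite ge_min lexx orbT.
  apply: dP; rewrite /= ?sub0r ?normrN ?gtr0_norm ?gt_eqF //.
  by rewrite in_itv/=; apply/andP; split; lra.
exists (- Num.min (d / 2) (x - a)).
set h := Num.min _ _.
have h0 : 0 < h by rewrite lt_min divr_gt0 // subr_gt0 (lt_le_trans ab) // leNgt.
have hd : h < d by rewrite gt_min ltr_pdivrMr // ltr_pMr // ltr1n.
have hb : h <= x - a by rewrite ge_min lexx orbT.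
apply: dP; rewrite /= ?sub0r ?opprK ?gtr0_norm ?oppr_eq0 ?gt_eqF //.
by rewrite in_itv/=; apply/andP; split; lra.
Qed.

Lemma derive_within_unique (R : realType) (W : normedModType R) (a b : R)
    (f : R -> W) x (l : W) :
  a < b -> x \in `[a, b] ->
  (forall e, 0 < e -> exists2 d, 0 < d &
    forall y, y \in `[a, b] -> `|x - y| < d ->
      `|f y - f x - (y - x) *: l| <= e * `|y - x|) ->
  derivable_within `[a, b] f x /\ derive_within `[a, b] f x = l.
Proof.
move=> ab xab /(quotient_withinP `[a, b]%classic) fl.
have FF := segment_quotient_proper ab xab.
by split; [apply/cvg_ex; exists l | exact: cvg_lim].
Qed.

(** * Sup norms, and functions of class C1 on a segment or rectangle *)

Section SupNorm.
Context {R : realType} {W : normedModType R} {E : Type}.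
Implicit Types (D : set E) (g : E -> W).

Lemma sup_norm_ge D g x K :
  (forall y, D y -> `|g y| <= K) -> D x -> `|g x| <= sup_norm D g.
Proof.
move=> gK Dx; apply: ub_le_sup; last by exists x.
by exists K => _ [y Dy <-]; exact: gK.
Qed.

Lemma sup_norm_le D g K :
  D !=set0 -> (forall x, D x -> `|g x| <= K) -> sup_norm D g <= K.
Proof.
move=> [x Dx] gK; apply: ge_sup; first by exists `|g x|; exists x.
by move=> _ [y Dy <-]; exact: gK.
Qed.

Lemma sup_norm_ge0 D g : 0 <= sup_norm D g.
Proof.
rewrite /sup_norm; have [[[_ [x Dx _]] [K KP]]|/sup_out->//] :=
  pselect (has_sup [set `|g p| | p in D]).
by rewrite (le_trans (normr_ge0 (g x))) // (sup_norm_ge (K := K)) // => y Dy;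
  apply: KP; exists y.
Qed.

End SupNorm.

Section Within.
Context {R : realType} {W : normedModType R}.
Implicit Types (a b : R) (f : R -> W).

Lemma C1_norm_ge0 (I : set R) f : 0 <= C1_norm I f.
Proof. by rewrite addr_ge0 // sup_norm_ge0. Qed.

Lemma derivable_within_segment_continuous (I : set R) f :
  (forall x, I x -> derivable_within I f x) -> {within I, continuous f}.
Proof.
move=> df; apply/within_continuousP => x Ix e e0.
have [d d0 dP] := derivable_withinE (df x Ix) ltr01.
set p := derive_within I f x in dP.
have p1 : 0 < 1 + `|p| by rewrite ltr_wpDr.
exists (Num.min d (e / (1 + `|p|))); first by rewrite lt_min d0 divr_gt0.
move=> y Iy; rewrite lt_min => /andP[xyd]; rewrite ltr_pdivlMr // => xye.
have := dP y Iy xyd; rewrite mul1r => H.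
rewrite distrC -(subrK ((y - x) *: p) (f y - f x)) (le_trans (ler_normD _ _)) //.
rewrite (le_trans _ (ltW xye)) // mulrDr mulr1 normrZ (distrC x y).
by rewrite lerD2r.
Qed.

Lemma increment_le_ordered a b c d f p K :
  (forall x, x \in `[a, b] -> derivable_within `[a, b] f x) ->
  a <= c -> c <= d -> d <= b ->
  (forall x, x \in `[c, d] -> `|derive_within `[a, b] f x - p| <= K) ->
  `|f d - f c - (d - c) *: p| <= K * (d - c).
Proof.
move=> df ac cd db fK.
have sub x : x \in `[c, d] -> x \in `[a, b].
  rewrite !in_itv/= => /andP[cx xd].
  by rewrite (le_trans ac) //= (le_trans xd).
pose g x := f x - (x - c) *: p.
have -> : f d - f c - (d - c) *: p = g d - g c.
  by rewrite /g subrr scale0r subr0 addrAC.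
have gE x y : g y - g x = f y - f x - (y - x) *: p.
  have -> : (y - x) *: p = (y - c) *: p - (x - c) *: p.
    by rewrite -scalerBl opprB addrA subrK.
  by rewrite /g !opprB addrACA [RHS]addrACA (addrC (- f x)).
apply: mean_value_le => //.
  apply/within_continuousP => x xcd e e0.
  have [d' d'0 d'P] := derivable_withinE (df x (sub _ xcd)) ltr01.
  set q := derive_within _ f x in d'P.
  have q1 : 0 < 1 + `|q - p| by rewrite ltr_wpDr.
  exists (Num.min d' (e / (1 + `|q - p|))); first by rewrite lt_min d'0 divr_gt0.
  move=> y ycd; rewrite lt_min => /andP[xyd]; rewrite ltr_pdivlMr // => xye.
  have := d'P y (sub _ ycd) xyd; rewrite mul1r => H.
  rewrite distrC gE -(subrK ((y - x) *: q) (f y - f x)) -addrA -scalerBr.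
  rewrite (le_trans (ler_normD _ _)) // (le_trans _ (ltW xye)) //.
  by rewrite mulrDr mulr1 normrZ (distrC x y) lerD2r.
move=> t /andP[ct td] e r e0 r0.
have tcd : t \in `[c, d] by rewrite in_itv/= ct ltW.
have [d' d'0 d'P] := derivable_withinE (df t (sub _ tcd)) e0.
pose s := Num.min (Num.min (r / 2) (d' / 2)) (d - t).
have s0 : 0 < s by rewrite !lt_min subr_gt0 td !divr_gt0.
have hr : s <= r / 2 by rewrite !ge_min lexx.
have hd : s <= d' / 2 by rewrite !ge_min lexx !orbT.
have hdt : s <= d - t by rewrite !ge_min lexx !orbT.
exists s; first by rewrite s0 /=; lra.
split; first by lra.
have scd : t + s \in `[c, d] by rewrite in_itv/=; apply/andP; split; lra.
have := d'P _ (sub _ scd); rewrite opprD addNKr normrN gtr0_norm //.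
have -> : t + s - t = s by rewrite addrAC subrr add0r.
move=> H; rewrite gE (addrAC t) subrr add0r.
set q := derive_within _ f t in H.
rewrite -(subrK (s *: q) (f (t + s) - f t)) -addrA -scalerBr.
rewrite (le_trans (ler_normD _ _)) // addrC mulrDr.
rewrite normrZ (gtr0_norm s0) lerD ?ler_pM2l ?fK //.
by rewrite (le_trans (H _)) ?gtr0_norm 1?mulrC //; lra.
Qed.

(** Subtracting a constant vector p from the derivative turns the mean value
    inequality into a first-order expansion, uniform wherever the derivative
    stays close to p. *)
Lemma increment_le a b f x y p K :
  (forall x, x \in `[a, b] -> derivable_within `[a, b] f x) ->
  x \in `[a, b] -> y \in `[a, b] ->
  (forall s, s \in `[a, b] -> `|s - x| <= `|y - x| ->
     `|derive_within `[a, b] f s - p| <= K) ->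
  `|f y - f x - (y - x) *: p| <= K * `|y - x|.
Proof.
move=> df; rewrite !in_itv/= => /andP[ax xb] /andP[ay yb] fK.
have [xy|/ltW yx] := leP x y.
  rewrite ger0_norm ?subr_ge0 //; apply: (increment_le_ordered df) => // s.
  rewrite in_itv/= => /andP[xs sy]; apply: fK.
    by rewrite in_itv/= (le_trans ax) //= (le_trans sy).
  by rewrite !ger0_norm ?subr_ge0 ?lerD2r.
rewrite (distrC y) (ger0_norm (_ : 0 <= x - y)) ?subr_ge0 //.
have -> : f y - f x - (y - x) *: p = - (f x - f y - (x - y) *: p).
  by rewrite opprB opprB -scaleNr opprB addrC.
rewrite normrN; apply: (increment_le_ordered df) => // s.
rewrite in_itv/= => /andP[ys sx]; apply: fK.
  by rewrite in_itv/= (le_trans ay) //= (le_trans sx).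
by rewrite !(distrC _ x) !ger0_norm ?subr_ge0 // lerD2l lerN2.
Qed.

Lemma derive_within_lipschitz a b f x y K :
  (forall x, x \in `[a, b] -> derivable_within `[a, b] f x) ->
  (forall x, x \in `[a, b] -> `|derive_within `[a, b] f x| <= K) ->
  x \in `[a, b] -> y \in `[a, b] -> `|f y - f x| <= K * `|y - x|.
Proof.
move=> df fK xab yab.
have := @increment_le a b f x y 0 K df xab yab.
by rewrite scaler0 subr0; apply => s sab _; rewrite subr0 fK.
Qed.

Lemma C1_within_le_norm a b f x : C1_within `[a, b] f -> x \in `[a, b] ->
  `|f x| <= C1_norm `[a, b] f /\
  `|derive_within `[a, b] f x| <= C1_norm `[a, b] f.
Proof.
move=> [df cdf] xab; have cab := @segment_compact R a b.
have [K KP] := compact_image_bounded cab (derivable_within_segment_continuous df).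
have [K' KP'] := compact_image_bounded cab cdf.
split; first by rewrite ler_wpDr ?sup_norm_ge0 // (sup_norm_ge KP).
by rewrite ler_wpDl ?sup_norm_ge0 // (sup_norm_ge KP').
Qed.

(** Variant of the preceding lemma for the observations, which are obtained by
    the chain rule: a bound on the derivative replaces its continuity. *)
Lemma bounded_derivable_le_norm a b f K x :
  (forall x, x \in `[a, b] -> derivable_within `[a, b] f x) ->
  (forall x, x \in `[a, b] -> `|derive_within `[a, b] f x| <= K) ->
  x \in `[a, b] ->
  `|f x| <= C1_norm `[a, b] f /\
  `|derive_within `[a, b] f x| <= C1_norm `[a, b] f.
Proof.
move=> df dK xab; have cab := @segment_compact R a b.
have [K' KP] := compact_image_bounded cab (derivable_within_segment_continuous df).
split; first by rewrite ler_wpDr ?sup_norm_ge0 // (sup_norm_ge KP).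
by rewrite ler_wpDl ?sup_norm_ge0 // (sup_norm_ge dK).
Qed.

(** Joint differentiability at (t, x) relatively to a rectangle, which makes sense
    up to its sides and corners; characteristics are oblique, so that partial
    derivatives alone are not enough. *)
Definition diff_rect (I J : set R) (u : R -> R -> W) t x (p q : W) :=
  forall e, 0 < e -> exists2 d, 0 < d &
    forall t' x', I t' -> J x' -> `|t' - t| < d -> `|x' - x| < d ->
      `|u t' x' - u t x - (t' - t) *: p - (x' - x) *: q|
        <= e * (`|t' - t| + `|x' - x|).

(** One path of the increment is along x, where the partial derivative at (t, x)
    itself is used, the other along t at the shifted abscissa, where the mean
    value inequality and the continuity of the t-derivative are used. *)
Lemma C1_rect_diff a b c d (u : R -> R -> W) t x :
  C1_rect `[a, b] `[c, d] u -> t \in `[a, b] -> x \in `[c, d] ->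
  diff_rect `[a, b] `[c, d] u t x (dt `[a, b] u t x) (dx `[c, d] u t x).
Proof.
move=> [du_t du_x _ cdt _] tab xcd e e0.
have [d1 d10 d1P] := derivable_withinE (du_x t x tab xcd) e0.
move/within_continuousP: cdt => /(_ (t, x) (conj tab xcd) e e0) [d2 d20 d2P].
exists (Num.min d1 d2); first by rewrite lt_min d10.
move=> t' x' t'ab x'cd; rewrite !lt_min => /andP[_ t2] /andP[x1 x2].
set p := dt _ u t x; set q := dx _ u t x.
have -> : u t' x' - u t x - (t' - t) *: p - (x' - x) *: q =
    (u t' x' - u t x' - (t' - t) *: p) + (u t x' - u t x - (x' - x) *: q).
  rewrite [RHS]addrACA -!addrA; congr (_ + _).
  by rewrite !addrA addNr add0r addrAC -!addrA.
rewrite (le_trans (ler_normD _ _)) // mulrDr lerD //; last first.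
  by apply: d1P => //; rewrite distrC.
apply: (@increment_le a b (u ^~ x')) => //.
  by move=> s sab; apply: du_t.
move=> s sab st; have := d2P (s, x') (conj sab x'cd).
move=> H; rewrite distrC; apply: H.
rewrite [ltLHS]/Num.norm/= gt_max /= distrC (le_lt_trans st) //=.
by rewrite distrC.
Qed.

Lemma C1_rect_le_norm a b c d (u : R -> R -> W) D t x :
  C1_rect `[a, b] `[c, d] u -> C1_rect_norm `[a, b] `[c, d] u <= D ->
  t \in `[a, b] -> x \in `[c, d] ->
  [/\ `|u t x| <= D, `|dt `[a, b] u t x| <= D & `|dx `[c, d] u t x| <= D].
Proof.
move=> [_ _ cu cdt cdx] uD tab xcd.
have cR : compact (`[a, b]%classic `*` `[c, d]%classic : set (R * R)).
  by apply: compact_setX; exact: segment_compact.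
have tx : (`[a, b]%classic `*` `[c, d]%classic) (t, x) by [].
have [K1 K1P] := compact_image_bounded cR cu.
have [K2 K2P] := compact_image_bounded cR cdt.
have [K3 K3P] := compact_image_bounded cR cdx.
have := sup_norm_ge K1P tx; have := sup_norm_ge K2P tx.
have := sup_norm_ge K3P tx => /= h3 h2 h1.
move: uD; rewrite /C1_rect_norm => uD.
have := sup_norm_ge0 (`[a, b]%classic `*` `[c, d]%classic)
  (fun p : R * R => u p.1 p.2).
have := sup_norm_ge0 (`[a, b]%classic `*` `[c, d]%classic)
  (fun p : R * R => dt `[a, b] u p.1 p.2).
have := sup_norm_ge0 (`[a, b]%classic `*` `[c, d]%classic)
  (fun p : R * R => dx `[c, d] u p.1 p.2).
move: h1 h2 h3 uD; set s1 := sup_norm _ _; set s2 := sup_norm _ _.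
set s3 := sup_norm _ _; move=> h1 h2 h3 uD g3 g2 g1.
by split; lra.
Qed.

End Within.

Lemma derive_within_le (R : realType) (W : normedModType R) (a b r K : R)
    (g : R -> W) t :
  a < b -> t \in `[a, b] -> derivable_within `[a, b] g t -> 0 < r ->
  (forall s, s \in `[a, b] -> `|t - s| < r -> `|g s - g t| <= K * `|s - t|) ->
  `|derive_within `[a, b] g t| <= K.
Proof.
move=> ab tab dg r0 gK; apply/ler_addgt0Pl => e e0.
have [d d0 dP] := derivable_withinE dg e0.
have FF := segment_quotient_proper ab tab.
have [h [hd [h0 hab]]] : exists h, `|h| < Num.min d r /\ h != 0 /\ t + h \in `[a, b].
  apply: (@filter_ex _ _ FF); rewrite /within /=.
  apply/nbhs_normP; exists (Num.min d r); first by rewrite /= lt_min d0.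
  by move=> h; rewrite /ball_/= sub0r normrN.
move: hd; rewrite lt_min => /andP[hd hr].
have th : t - (t + h) = - h by rewrite opprD addNKr.
have ht : t + h - t = h by rewrite addrAC subrr add0r.
have := dP (t + h) hab; rewrite th ht normrN => /(_ hd) H1.
have := gK (t + h) hab; rewrite th ht normrN => /(_ hr) H2.
rewrite -(ler_pM2l (_ : 0 < `|h|)) ?normr_gt0 // -normrZ.
set q := derive_within _ _ _ in H1 *.
have -> : h *: q = (g (t + h) - g t) - (g (t + h) - g t - h *: q).
  by rewrite opprB addrC subrK.
by rewrite (le_trans (ler_normB _ _)) // addrC mulrDr !(mulrC `|h|) lerD.
Qed.


(** * Lipschitz bounds from bounded partial derivatives *)

Lemma mx_entry_le (R : realType) m n (A : 'M[R]_(m, n)) i j : `|A i j| <= `|A|.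
Proof.
rewrite [leRHS]/Num.norm/= mx_normrE.
exact: (le_bigmax 0 (fun ij : 'I_m * 'I_n => `|A ij.1 ij.2|) (i, j)).
Qed.

Lemma mx_norm_le (R : realType) m n (A : 'M[R]_(m, n)) K :
  0 <= K -> (forall i j, `|A i j| <= K) -> `|A| <= K.
Proof.
move=> K0 AK; rewrite [leLHS]/Num.norm/= mx_normrE.
by apply: bigmax_le => // -[i j] _; exact: AK.
Qed.

Lemma cV_norm_attained (R : realType) n (v : 'cV[R]_n) :
  `|v| = 0 \/ exists i, `|v| = `|v i 0|.
Proof.
have [->|v0] := eqVneq v 0; first by left; rewrite normr0.
right; have [|[i j] /= vij] := @mx_norm_neq0 _ _ _ v.
  by rewrite -[mx_norm v]/(`|v|) normr_eq0.
by exists i; rewrite -(ord1 j); exact: vij.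
Qed.

Lemma mulmx_norm_le (R : realType) m n (A : 'M[R]_(m, n)) (w : 'cV[R]_n) :
  `|A *m w| <= n%:R * `|A| * `|w|.
Proof.
apply: mx_norm_le => [|i j]; first by rewrite !mulr_ge0 ?ler0n.
rewrite mxE (le_trans (ler_norm_sum _ _ _)) //.
have -> : n%:R * `|A| * `|w| = \sum_(k < n) `|A| * `|w|.
  by rewrite sumr_const card_ord mulr_natl mulrnAl.
by rewrite ler_sum // => k _; rewrite normrM ler_pM // mx_entry_le.
Qed.

Lemma bounded_partials_derive (R : realType) (n : nat) (W : normedModType R)
    (f : 'cV[R]_n -> W) a v K :
  differentiable f a -> (forall j, `|'D_(delta_mx j 0) f a| <= K) ->
  `|'D_v f a| <= n%:R * K * `|v|.
Proof.
move=> df fK; rewrite deriveE // [v in 'd f a v](matrix_sum_delta v) raddf_sum.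
have dE j : 'd f a (\sum_(k < 1) v j k *: delta_mx j k) =
    v j 0 *: 'D_(delta_mx j 0) f a.
  rewrite big_ord1 deriveE //.
  by rewrite linearZ.
rewrite (eq_bigr _ (fun j _ => dE j)).
rewrite (le_trans (ler_norm_sum _ _ _)) //.
have -> : n%:R * K * `|v| = \sum_(j < n) K * `|v|.
  by rewrite sumr_const card_ord mulr_natl mulrnAl.
rewrite ler_sum // => j _.
rewrite normrZ mulrC ler_pM //.
exact: mx_entry_le.
Qed.

(** Mean value inequality on the segment from a to b, which stays in the ball. *)
Lemma bounded_partials_lipschitz (R : realType) (n : nat) (W : normedModType R)
    (f : 'cV[R]_n -> W) r K a b :
  (forall x, `|x| < r -> differentiable f x) ->
  (forall x j, `|x| < r -> `|'D_(delta_mx j 0) f x| <= K) ->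
  `|a| < r -> `|b| < r -> `|f b - f a| <= n%:R * K * `|b - a|.
Proof.
move=> df fK ar br; pose h (s : R) := s *: (b - a) + a.
have hr s : 0 <= s <= 1 -> `|h s| < r.
  move=> /andP[s0 s1].
  have -> : h s = s *: b + (1 - s) *: a.
    by rewrite /h scalerBr scalerBl scale1r -addrA (addrC (- _)).
  rewrite (le_lt_trans (ler_normD _ _)) // !normrZ !ger0_norm ?subr_ge0 //.
  have [->|s0'] := eqVneq s 0; first by rewrite mul0r add0r subr0 mul1r.
  have -> : r = s * r + (1 - s) * r by ring.
  by rewrite ltr_leD // ?ltr_pM2l ?lt0r ?s0' // ler_wpM2l ?subr_ge0 // ltW.
pose g s := f (h s).
have -> : f b - f a = g 1 - g 0.
  by rewrite /g /h scale1r scale0r subrK add0r.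
have := @mean_value_le R W g 0 1 (n%:R * K * `|b - a|) ler01.
rewrite subr0 mulr1; apply.
  apply/subspace_continuousP => s; rewrite /= in_itv /= => s01.
  apply: (@cvg_comp _ _ _ h f _ (nbhs (h s))); last first.
    exact: (differentiable_continuous (df _ (hr _ s01))).
  apply: cvgD; last exact: cvg_cst.
  by apply: cvgZ; [exact: cvg_within | exact: cvg_cst].
move=> t /andP[t0 t1] e d e0 d0.
have t01 : 0 <= t <= 1 by rewrite t0 ltW.
have := @diff_derivable _ _ _ f (h t) (b - a) (df _ (hr _ t01)).
move=> /cvgrPdist_le /(_ e e0) /nbhs_normP[d' /= d'0 d'P].
pose s := Num.min (Num.min (d / 2) (d' / 2)) (1 - t).
have s0 : 0 < s by rewrite !lt_min subr_gt0 t1 !divr_gt0.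
have hsd : s <= d / 2 by rewrite !ge_min lexx.
have hsd' : s <= d' / 2 by rewrite !ge_min lexx !orbT.
have hst : s <= 1 - t by rewrite !ge_min lexx !orbT.
exists s; first by rewrite s0 /=; lra.
split; first by lra.
have := d'P s; rewrite /= sub0r normrN gtr0_norm // => /(_ _ _) H.
have {H} : `|'D_(b - a) f (h t) - s^-1 *: (f (s *: (b - a) + h t) - f (h t))| <= e.
  by apply: H; [lra | rewrite gt_eqF].
have -> : s *: (b - a) + h t = h (t + s) by rewrite /h scalerDl addrA (addrC (s *: _)).
move=> H; rewrite -/(g t) -/(g (t + s)).
have -> : g (t + s) - g t = s *: (s^-1 *: (g (t + s) - g t)).
  by rewrite scalerA divff ?scale1r // gt_eqF.
rewrite normrZ gtr0_norm // ler_pM2l //.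
rewrite -(subrK ('D_(b - a) f (h t)) (s^-1 *: _)) (le_trans (ler_normD _ _)) //.
rewrite addrC lerD //; last by rewrite distrC.
apply: bounded_partials_derive; first exact/df/hr.
by move=> j; apply/fK/hr.
Qed.

Lemma finite_uniform (R : realType) (I : finType) (P : I -> R -> Prop) :
  (forall i c c', 0 < c -> c <= c' -> P i c -> P i c') ->
  (forall i, exists2 c, 0 < c & P i c) ->
  exists2 c, 0 < c & forall i, P i c.
Proof.
move=> mP exP.
have /choice[c cP] : forall i, exists c, 0 < c /\ P i c.
  by move=> i; have [c c0 Pc] := exP i; exists c.
have cge0 i : 0 <= c i by have [/ltW] := cP i.
exists (\sum_i c i + 1); first by rewrite ltr_wpDl // sumr_ge0.
move=> i; have [c0 Pi] := cP i; apply: (mP i (c i)) => //.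
by rewrite (bigD1 i) //= -addrA lerDl addr_ge0 // sumr_ge0.
Qed.

Lemma lt_inv_le (R : realFieldType) (x c c' : R) :
  0 < c -> c <= c' -> x < c'^-1 -> x < c^-1.
Proof.
move=> c0 cc' xc; rewrite (lt_le_trans xc) // lef_pV2 // posrE //.
exact: lt_le_trans cc'.
Qed.

(** One radius and one constant serve all members f k of the family; it is used
    with a single function, and with the functions G t for t in [0, T]. *)
Lemma lipschitz_near0 (R : realType) (n : nat) (W : normedModType R) (X : Type)
    (A : set X) (V : set 'cV[R]_n) (f : X -> 'cV[R]_n -> W) :
  open V -> V 0 -> (forall k a, A k -> V a -> differentiable (f k) a) ->
  (forall j, exists2 c, 0 < c & forall k y, A k -> V y -> `|y| < c^-1 ->
     `|'D_(delta_mx j 0) (f k) y| <= c) ->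
  exists2 c, 0 < c & forall k a b, A k -> `|a| < c^-1 -> `|b| < c^-1 ->
    V a /\ `|f k b - f k a| <= c * `|b - a|.
Proof.
move=> oV V0 df fc.
have /nbhs_normP[r /= r0 rV] : nbhs (0 : 'cV[R]_n) V by exact: open_nbhs_nbhs.
have [|c c0 cP] := @finite_uniform R 'I_n (fun j c => forall k y, A k -> V y ->
    `|y| < c^-1 -> `|'D_(delta_mx j 0) (f k) y| <= c) _ fc.
  move=> j c c' c0 cc' H k y Ak Vy yc; apply: (le_trans _ cc'); apply: H => //.
  exact: lt_inv_le c0 cc' yc.
have nc : 0 <= n%:R * c by rewrite mulr_ge0 ?ler0n // ltW.
have r'0 : 0 < r^-1 by rewrite invr_gt0.
pose C := r^-1 + c + n%:R * c.
have C0 : 0 < C by rewrite ltr_wpDr // addr_gt0.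
have Cr (x : 'cV[R]_n) : `|x| < C^-1 -> V x.
  move=> xC; apply: rV; rewrite /ball_ /= sub0r normrN -(invrK r).
  by apply: (lt_inv_le _ _ xC) => //; rewrite /C; lra.
have Cc (x : 'cV[R]_n) : `|x| < C^-1 -> `|x| < c^-1.
  by apply: lt_inv_le => //; rewrite /C; lra.
exists C => // k a b Ak aC bC; split; first exact: Cr.
apply: (@le_trans _ _ (n%:R * c * `|b - a|)); last first.
  by rewrite ler_wpM2r // /C; lra.
apply: (bounded_partials_lipschitz (r := C^-1)) => // x.
  by move=> /Cr; exact: df.
by move=> j xC; apply: cP => //; [exact: Cr | exact: Cc].
Qed.

Lemma C1_open_lipschitz (R : realType) (n : nat) (W : normedModType R)
    (U : set 'cV[R]_n) (f : 'cV[R]_n -> W) :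
  open U -> U 0 -> C1_open U f ->
  exists2 c, 0 < c & forall a b, `|a| < c^-1 -> `|b| < c^-1 ->
    U a /\ `|f b - f a| <= c * `|b - a|.
Proof.
move=> oU U0 [df cf].
have [||c c0 cP] := @lipschitz_near0 R n W unit setT U (fun=> f) oU U0.
- by move=> _ a _; exact: df.
- move=> j; have /within_continuousP/(_ 0 U0 1 ltr01)[d d0 dP] :=
    cf (delta_mx j 0).
  have K0 : 0 < `|'D_(delta_mx j 0) f 0| + 1 by rewrite ltr_wpDl.
  set K := _ + 1 in K0; have d'0 : 0 < d^-1 by rewrite invr_gt0.
  exists (d^-1 + K); first by rewrite addr_gt0.
  move=> _ y _ Uy yd; have := dP y Uy; rewrite sub0r normrN => /(_ _) H.
  rewrite -(subrK ('D_(delta_mx j 0) f 0) ('D_(delta_mx j 0) f y)).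
  rewrite (le_trans (ler_normD _ _)) // distrC.
  have yd' : `|y| < d.
    by rewrite -(invrK d); apply: lt_inv_le _ _ yd => //; rewrite lerDl ltW.
  by have := H yd'; rewrite /K; lra.
by exists c => // a b; exact: (cP tt a b I).
Qed.

(** * The boundary functions near the zero state *)

Section BoundaryFunction.
Context {R : realType} {n : nat} {W : normedModType R}.
Context (T : R) (V : set 'cV[R]_n) (G : R -> 'cV[R]_n -> W).
Context (T0 : 0 < T) (oV : open V) (V0 : V 0).
Context (G_C1 : C1_time_open `[0, T] V G).
Context (Gt_lip : locally_lipschitz_snd `[0, T] V
     (fun t v => derive_within `[0, T] (G ^~ v) t)).
Context (G0 : forall t, t \in `[0, T] -> G t 0 = 0).

Lemma boundary_lipschitz :
  exists2 c, 0 < c & forall t a b, t \in `[0, T] -> `|a| < c^-1 ->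
    `|b| < c^-1 -> V a /\ `|G t b - G t a| <= c * `|b - a|.
Proof.
have [_ dG _ _ cG] := G_C1.
apply: (lipschitz_near0 (A := `[0, T]%classic)) => // j.
set e := delta_mx j 0.
have [||c c0 cP] := @segment_uniform R 0 T (fun c t => forall y, V y ->
    `|y| < c^-1 -> `|'D_e (G t) y| <= c).
- move=> c c' t c0 cc' H y Vy yc; apply: (le_trans _ cc'); apply: H => //.
  exact: lt_inv_le c0 cc' yc.
- move=> t t0T; have /within_continuousP/(_ (t, 0) _ 1 ltr01)[|d d0 dP] := cG e.
    by split.
  have K0 : 0 < `|'D_e (G t) 0| + 1 by rewrite ltr_wpDl.
  set K := _ + 1 in K0; have d'0 : 0 < d^-1 by rewrite invr_gt0.
  exists d => //; exists (d^-1 + K); first by rewrite addr_gt0.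
  move=> s s0T ts y Vy yd; have := dP (s, y) (conj s0T Vy).
  rewrite [ltLHS]/Num.norm/= gt_max /= ts sub0r normrN /= => H.
  rewrite -(subrK ('D_e (G t) 0) ('D_e (G s) y)).
  rewrite (le_trans (ler_normD _ _)) // distrC.
  have yd' : `|y| < d.
    by rewrite -(invrK d); apply: lt_inv_le _ _ yd => //; rewrite lerDl ltW.
  by have := H yd'; rewrite /K; lra.
by exists c => // t y tT; exact: cP.
Qed.

(** The t-derivative of G vanishes at the zero state, because G does for all t;
    being Lipschitz in the state, it is then bounded by a multiple of it. *)
Lemma boundary_time_derivative :
  exists2 c, 0 < c & forall t a, t \in `[0, T] -> V a -> `|a| < c^-1 ->
    `|derive_within `[0, T] (G ^~ a) t| <= c * `|a|.
Proof.
have [||c c0 cP] := @segment_uniform R 0 T (fun c t => forall a, V a ->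
    `|a| < c^-1 -> `|derive_within `[0, T] (G ^~ a) t| <= c * `|a|).
- move=> c c' t c0 cc' H y Vy yc; apply: (@le_trans _ _ (c * `|y|)).
    apply: H => //.
    exact: lt_inv_le c0 cc' yc.
  by rewrite ler_wpM2r.
- move=> t t0T; have [K [N /nbhs_normP[d /= d0 dN] KP]] := Gt_lip t0T V0.
  have d'0 : 0 < d^-1 by rewrite invr_gt0.
  exists d => //; exists (d^-1 + `|K|); first by rewrite ltr_wpDr.
  move=> s s0T ts a Va ad.
  have ad' : `|a| < d.
    by rewrite -(invrK d); apply: lt_inv_le _ _ ad => //; rewrite lerDl.
  have N0 : N (s, 0).
    by apply: dN; rewrite /ball_/= [ltLHS]/Num.norm/= gt_max /= ts subr0 normr0.
  have Na : N (s, a).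
    by apply: dN; rewrite /ball_/= [ltLHS]/Num.norm/= gt_max /= ts sub0r normrN.
  have := KP s s0T (a, 0) (conj (conj Va Na) (conj V0 N0)) => /=.
  rewrite subr0.
  have -> : derive_within `[0, T] (G ^~ 0) s = 0.
    apply: (derive_within_unique T0 s0T _).2 => e e0; exists 1 => // y yT _.
    by rewrite !G0 // subrr scaler0 subr0 normr0 mulr_ge0 // ltW.
  rewrite subr0 => H; rewrite (le_trans H) // ler_wpM2r //.
  by rewrite (le_trans (ler_norm _)) // lerDr ltW.
by exists c => // t a tT; exact: cP.
Qed.

(** Even the increment of G in t is proportional to the size of the state. This
    is what makes the time increments of the incoming coordinates small with
    the observations, and it is where the Lipschitz condition on the
    t-derivative of G enters. *)
Lemma boundary_increment :
  exists2 c, 0 < c & forall t t' a b, t \in `[0, T] -> t' \in `[0, T] ->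
    `|a| < c^-1 -> `|b| < c^-1 ->
    `|G t' b - G t a| <= c * `|b - a| + c * `|a| * `|t' - t|.
Proof.
have [c1 c10 P1] := boundary_lipschitz.
have [c2 c20 P2] := boundary_time_derivative.
have [dG _ _ _ _] := G_C1.
have c12 : 0 < c1 + c2 by rewrite addr_gt0.
exists (c1 + c2) => // t t' a b tT t'T aC bC.
have small1 (x : 'cV[R]_n) : `|x| < (c1 + c2)^-1 -> `|x| < c1^-1.
  by apply: lt_inv_le => //; rewrite lerDl ltW.
have small2 (x : 'cV[R]_n) : `|x| < (c1 + c2)^-1 -> `|x| < c2^-1.
  by apply: lt_inv_le => //; rewrite lerDr ltW.
have [Va H1] := P1 t' a b t'T (small1 _ aC) (small1 _ bC).
have -> : G t' b - G t a = (G t' b - G t' a) + (G t' a - G t a).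
  by rewrite addrA subrK.
rewrite (le_trans (ler_normD _ _)) // lerD //.
  by rewrite (le_trans H1) // ler_wpM2r // lerDl ltW.
apply: (@le_trans _ _ (c2 * `|a| * `|t' - t|)); last first.
  by rewrite -!mulrA ler_wpM2r ?mulr_ge0 // lerDr ltW.
apply: (@derive_within_lipschitz R W 0 T (G ^~ a)) => //.
  by move=> s sT; apply: dG.
by move=> s sT; apply: P2 => //; exact: small2.
Qed.

End BoundaryFunction.

(** * Differentiability of the characteristic variables *)

Lemma derive_within_comp (R : realType) (X W : normedModType R) (a b : R)
    (g : R -> X) (f : X -> W) t p :
  a < b -> t \in `[a, b] -> differentiable f (g t) ->
  (forall e, 0 < e -> exists2 d, 0 < d &
    forall s, s \in `[a, b] -> `|t - s| < d ->
      `|g s - g t - (s - t) *: p| <= e * `|s - t|) ->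
  derivable_within `[a, b] (f \o g) t /\
  derive_within `[a, b] (f \o g) t = 'd f (g t) p.
Proof.
move=> ab tab df gp; apply: derive_within_unique => // e e0.
have [dc /eqaddoP fE] := (diff_locallyP (g t) f).1 df.
have [k k0 kP] := linear_lipschitz dc.
have P0 : 0 < `|p| + 1 by rewrite ltr_wpDl.
pose e1 := e / 2 / (`|p| + 1).
have e10 : 0 < e1 by rewrite !divr_gt0.
have /nbhs_normP[d1 /= d10 d1P] := fE e1 e10.
pose e2 := Num.min 1 (e / 2 / k).
have e20 : 0 < e2 by rewrite lt_min ltr01 !divr_gt0.
have [d2 d20 d2P] := gp e2 e20.
exists (Num.min d2 (d1 / (`|p| + 1))); first by rewrite lt_min d20 divr_gt0.
move=> s sab; rewrite lt_min => /andP[sd2]; rewrite ltr_pdivlMr // => sd1.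
have gs := d2P s sab sd2.
have gs1 : `|g s - g t| <= (`|p| + 1) * `|s - t|.
  rewrite -(subrK ((s - t) *: p) (g s - g t)) (le_trans (ler_normD _ _)) //.
  rewrite mulrDl mul1r addrC lerD // ?normrZ 1?mulrC // (le_trans gs) //.
  by rewrite ler_piMl // ge_min lexx.
have := d1P (g s - g t); rewrite /ball_/= sub0r normrN => /(_ _) H1.
have {}H1 : `|f (g s) - (f (g t) + 'd f (g t) (g s - g t))| <=
    e1 * `|g s - g t|.
  have := H1; set y := g s - g t; set D := (_ \o _ - _).
  have -> : D y = f (y + g t) - (f (g t) + 'd f (g t) y) by [].
  rewrite [y + g t]subrK; apply.
  by rewrite (le_lt_trans gs1) // mulrC distrC.
have -> : (f \o g) s - (f \o g) t - (s - t) *: 'd f (g t) p =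
   (f (g s) - (f (g t) + 'd f (g t) (g s - g t))) +
   'd f (g t) (g s - g t - (s - t) *: p).
  move: (g s - g t) => y /=; rewrite linearB /= opprD !addrA subrK.
  by congr (_ - _); rewrite linearZ.
rewrite (le_trans (ler_normD _ _)) // (splitr e) mulrDl lerD //.
  rewrite (le_trans H1) // (le_trans (ler_wpM2l (ltW e10) gs1)) //.
  by rewrite mulrA /e1 divfK // gt_eqF.
rewrite (le_trans (kP _)) // (le_trans (ler_wpM2l (ltW k0) gs)) //.
rewrite mulrA ler_wpM2r // mulrC -ler_pdivlMr //.
by rewrite ge_min lexx orbT.
Qed.

Lemma char_var_differentiable (R : realType) (n : nat)
    (l : 'I_n -> 'cV[R]_n -> 'rV[R]_n) i a :
  differentiable (l i) a -> differentiable (char_var l i) a.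
Proof.
move=> dl.
have -> : char_var l i =
    \sum_(j < n) ((fun x => l i x 0 j) * (fun x : 'cV[R]_n => x j 0)).
  by apply/funext => x; rewrite fct_sumE /char_var mxE.
apply: differentiable_sum => j; apply: differentiableM.
  exact: (differentiable_comp dl (differentiable_coord _ 0 j)).
exact: differentiable_coord.
Qed.

Section Pairing.
Context {R : realType} {n : nat}.
Implicit Types (a b : 'rV[R]_n) (w v : 'cV[R]_n).

Definition pairing a w : R := (a *m w) 0 0.

Lemma pairingDr a w v : pairing a (w + v) = pairing a w + pairing a v.
Proof. by rewrite /pairing mulmxDr mxE. Qed.

Lemma pairingBr a w v : pairing a (w - v) = pairing a w - pairing a v.
Proof. by rewrite /pairing mulmxBr !mxE. Qed.

Lemma pairingBl a b w : pairing (a - b) w = pairing a w - pairing b w.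
Proof. by rewrite /pairing mulmxBl !mxE. Qed.

Lemma pairingZr a k w : pairing a (k *: w) = k * pairing a w.
Proof. by rewrite /pairing -scalemxAr mxE. Qed.

Lemma pairing_le a w : `|pairing a w| <= n%:R * `|a| * `|w|.
Proof. by rewrite (le_trans (mx_entry_le _ _ _)) // mulmx_norm_le. Qed.

Lemma pairing_bound a w A B : `|a| <= A -> `|w| <= B ->
  `|pairing a w| <= n%:R * A * B.
Proof.
move=> aA wB; rewrite (le_trans (pairing_le _ _)) //.
by rewrite -!mulrA ler_wpM2l ?ler0n // ler_pM.
Qed.

End Pairing.

(** * A maximum principle *)

(** Maximise expR ((K + 1) * p) * N over the compact set D. If N exceeds M at a
    maximum point P, one can move from P inside D so that p grows at unit rate
    while N decreases at a rate not much larger than K * N; the weight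
    expR ((K + 1) * p) then outgrows the loss, contradicting maximality. *)
Lemma max_principle (R : realType) (D : set (R * R)) (N p : R * R -> R)
    (M K a b : R) :
  compact D -> {within D, continuous N} -> {within D, continuous p} ->
  0 <= M -> 0 <= K -> (forall P, D P -> a <= p P <= b) ->
  (forall P, D P -> N P <= M \/
     forall e r, 0 < e -> 0 < r -> exists2 s, 0 < s < r & exists2 Q, D Q &
       p P + s <= p Q /\ N P - s * (K * N P + e) <= N Q) ->
  forall P, D P -> N P <= M * expR ((K + 1) * (b - a)).
Proof.
move=> cD cN cp M0 K0 pab step P DP; set al := K + 1.
have al0 : 0 < al by rewrite ltr_wpDl.
pose F Q := expR (al * p Q) * N Q.
have cF : {within D, continuous F}.
  apply/subspace_continuousP => x Dx.
  move/subspace_continuousP: cN => /(_ x Dx) cNx.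
  move/subspace_continuousP: cp => /(_ x Dx) cpx.
  apply: cvgM => //; apply: cvg_comp; last exact: continuous_expR.
  by apply: cvgM => //; exact: cvg_cst.
have [|P0 /set_mem DP0 maxP0] := compact_EVT_max _ cD cF; first by exists P.
have NP0 : N P0 <= M.
  have [//|nM] := step _ DP0; rewrite leNgt; apply/negP => MZ.
  set Z := N P0 in nM MZ; have Z0 : 0 < Z by exact: le_lt_trans MZ.
  have e0 : 0 < Z / 4 by rewrite divr_gt0.
  have r0 : 0 < (4 * al ^+ 2)^-1 by rewrite invr_gt0 mulr_gt0 // exprn_gt0.
  have [s /andP[s0 sr] [Q DQ [pQ NQ]]] := nM _ _ e0 r0.
  have := maxP0 Q (mem_set DQ); apply/negP; rewrite -ltNge /F -/Z.
  have sal : s * al ^+ 2 < 4^-1.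
    by move: sr; rewrite invfM -ltr_pdivlMr ?exprn_gt0.
  have h1 : K * Z + Z / 4 <= al * Z.
    by rewrite /al mulrDl mul1r lerD2l; lra.
  have h2 : al * s * (K * Z + Z / 4) < Z / 4.
    apply: (@le_lt_trans _ _ ((s * al ^+ 2) * Z)).
      rewrite [leRHS](_ : _ = al * s * (al * Z)); last by ring.
      by rewrite ler_wpM2l // mulr_ge0 ?ltW.
    by rewrite mulrC ltr_pM2l.
  (* The choice of Z / 4 and of the step bound leaves a gain of at least s * Z / 2. *)
  have h3 : Z < (1 + al * s) * (Z - s * (K * Z + Z / 4)).
    have -> : (1 + al * s) * (Z - s * (K * Z + Z / 4)) =
      Z + s * (al * Z - (K * Z + Z / 4) - al * s * (K * Z + Z / 4)) by ring.
    rewrite ltrDl mulr_gt0 // /al mulrDl mul1r; rewrite /al in h2; lra.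
  have h4 : 0 < N Q.
    apply: lt_le_trans NQ.
    have : 0 < (1 + al * s) * (Z - s * (K * Z + Z / 4)) by exact: lt_trans h3.
    by rewrite pmulr_rgt0 // addr_gt0 // mulr_gt0.
  apply: (@lt_le_trans _ _ (expR (al * p P0) * ((1 + al * s) * N Q))).
    rewrite ltr_pM2l ?expR_gt0 //; apply: (lt_le_trans h3).
    by rewrite ler_wpM2l // addr_ge0 // mulr_ge0 ?ltW.
  rewrite mulrA ler_wpM2r ?(ltW h4) //.
  apply: (@le_trans _ _ (expR (al * p P0) * expR (al * s))).
    by rewrite ler_wpM2l ?expR_ge0 // expR_ge1Dx.
  by rewrite -expRD ler_expR -mulrDr ler_wpM2l // ltW.
have := maxP0 P (mem_set DP); rewrite /F => FP.
have /andP[aP _] := pab P DP; have /andP[_ P0b] := pab P0 DP0.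
rewrite -(ler_pM2l (expR_gt0 (al * p P))) (le_trans FP) //.
apply: (@le_trans _ _ (expR (al * p P0) * M)).
  by rewrite ler_pM2l ?expR_gt0.
rewrite mulrCA mulrC ler_wpM2l // -expRD ler_expR -mulrDr ler_pM2l //; lra.
Qed.

Lemma affine_continuous (R : realType) (a b d : R) :
  continuous (fun P : R * R => a * P.1 + b * P.2 + d).
Proof.
move=> P; apply: cvgD; last exact: cvg_cst.
by apply: cvgD; apply: cvgM; try exact: cvg_cst; [exact: cvg_fst | exact: cvg_snd].
Qed.

Lemma compact_halfplane (R : realType) (D : set (R * R)) (a b d : R) :
  compact D -> compact (D `&` [set P | 0 <= a * P.1 + b * P.2 + d]).
Proof.
move=> cD; apply: compact_closedI => //.
have -> : [set P : R * R | 0 <= a * P.1 + b * P.2 + d] =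
    (fun P => a * P.1 + b * P.2 + d) @^-1` [set x | 0 <= x] by [].
apply: closed_comp; last exact: closed_ge.
by move=> P _; exact: affine_continuous.
Qed.

(** * The difference of two solutions *)

Section Difference.
Context {R : realType} {n : nat}.
Context (l : 'I_n -> 'cV[R]_n -> 'rV[R]_n) (lambda : 'I_n -> 'cV[R]_n -> R).
Context (f : 'I_n -> 'cV[R]_n -> R) (c : R) (c0 : 0 < c).
Context (l_lip : forall i a b, `|a| < c^-1 -> `|b| < c^-1 ->
  `|l i b - l i a| <= c * `|b - a|).
Context (lambda_lip : forall i a b, `|a| < c^-1 -> `|b| < c^-1 ->
  `|lambda i b - lambda i a| <= c * `|b - a|).
Context (f_lip : forall i a b, `|a| < c^-1 -> `|b| < c^-1 ->
  `|f i b - f i a| <= c * `|b - a|).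
Context (l_le : forall i a, `|a| < c^-1 -> `|l i a| <= c).
Context (lambda_le : forall i a, `|a| < c^-1 -> `|lambda i a| <= c).

(** The pointwise content of being a small solution, with the derivatives
    quantified existentially. In this form it passes at once to time shifts, to
    shorter time intervals and to the zero function, the three competitors with
    which a solution is compared. *)
Definition char_solution (T L : R) (u : R -> R -> 'cV[R]_n) :=
  forall t x, t \in `[0, T] -> x \in `[0, L] -> `|u t x| < c^-1 /\
    exists p q, [/\ `|p| <= 1, `|q| <= 1,
      diff_rect `[0, T] `[0, L] u t x p q &
      forall i, pairing (l i (u t x)) (p + lambda i (u t x) *: q)
                = f i (u t x)].

(** Write w = u - v. In l_i(u) w_t + lambda_i(u) l_i(u) w_x the derivatives of u
    are eliminated by its equation, and those of v by its own equation up to the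
    differences of l_i, lambda_i and f_i between u and v, which are O(|w|).
    Hence l_i(u) w changes at a rate O(|w|) along the direction
    (1, lambda_i(u)). The variation of the factor l_i(u) is absorbed by its
    Lipschitz bound, so no derivative of l_i is taken. The direction is
    rescaled by k: forwards, backwards, or by 1 / lambda_i when x is the
    evolution variable. *)
Lemma char_increment (k0 : R) : 0 < k0 -> exists2 K, 0 <= K &
  forall T L u v t x i k e, char_solution T L u -> char_solution T L v ->
  t \in `[0, T] -> x \in `[0, L] -> `|k| <= k0 -> 0 < e ->
  exists2 d, 0 < d & forall s t' x', 0 < s -> s < d ->
    t' = t + s * k -> x' = x + s * (k * lambda i (u t x)) ->
    t' \in `[0, T] -> x' \in `[0, L] ->
    `|pairing (l i (u t' x')) (u t' x' - v t' x')
      - pairing (l i (u t x)) (u t x - v t x)|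
    <= s * (K * `|u t x - v t x| + e).
Proof.
move=> k00; pose B := k0 * (1 + c).
have c1 : 0 < 1 + c by rewrite addr_gt0.
have B0 : 0 < B by rewrite mulr_gt0.
have n0 : 0 <= n%:R :> R by exact: ler0n.
have nc0 : 0 <= n%:R * c by rewrite mulr_ge0 // ltW.
pose K := k0 * (c + n%:R * c * (1 + c) + n%:R * c * c) + 2 * (n%:R * c) * B.
have K0 : 0 <= K.
  by rewrite addr_ge0 // !mulr_ge0 ?addr_ge0 ?mulr_ge0 // ltW.
exists K => // T L u v t x i k e usol vsol tT xL kk0 e0.
have [usm [pu [qu [pu1 qu1 du eu]]]] := usol t x tT xL.
have [vsm [pv [qv [pv1 qv1 dv ev]]]] := vsol t x tT xL.
have {eu}eu := eu i; have {ev}ev := ev i.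
pose e1 := Num.min 1 (e / 2 / (2 * (n%:R * c) * B + 1)).
have X0 : 0 < 2 * (n%:R * c) * B + 1 by rewrite ltr_wpDl // !mulr_ge0 // ltW.
have Y0 : 0 < 8 * (n%:R * c) * B * B + 1 by rewrite ltr_wpDl // !mulr_ge0 // ltW.
have e10 : 0 < e1 by rewrite lt_min ltr01 !divr_gt0.
have e11 : e1 <= 1 by rewrite ge_min lexx.
have e1e : 2 * (n%:R * c) * B * e1 <= e / 2.
  apply: (@le_trans _ _ ((2 * (n%:R * c) * B + 1) * e1)).
    by rewrite ler_wpM2r ?(ltW e10) // lerDl.
  by rewrite mulrC -ler_pdivlMr // ge_min lexx orbT.
have [d1 d10 d1P] := du e1 e10; have [d2 d20 d2P] := dv e1 e10.
pose d := Num.min (Num.min (d1 / B) (d2 / B)) (e / 2 / (8 * (n%:R * c) * B * B + 1)).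
exists d; first by rewrite !lt_min !divr_gt0.
move=> s t' x' s0; rewrite !lt_min => /andP[/andP[sd1 sd2] sd3] t'E x'E t'T x'L.
have [u'sm _] := usol t' x' t'T x'L.
rewrite ltr_pdivlMr // in sd1; rewrite ltr_pdivlMr // in sd2.
set lam := lambda i (u t x) in x'E eu.
have lamc : `|lam| <= c by exact: lambda_le.
have dt_le : `|t' - t| <= s * k0.
  by rewrite t'E addrAC subrr add0r normrM gtr0_norm // ler_pM2l.
have dx_le : `|x' - x| <= s * (k0 * c).
  by rewrite x'E addrAC subrr add0r !normrM gtr0_norm // ler_pM2l // ler_pM.
have sB : s * k0 + s * (k0 * c) = s * B by rewrite /B; ring.
have skc : 0 <= s * (k0 * c) by rewrite !mulr_ge0 // ltW.
have sk : 0 <= s * k0 by rewrite !mulr_ge0 // ltW.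
have near d' : s * B < d' -> `|t' - t| < d' /\ `|x' - x| < d'.
  by move=> h; split; lra.
have [tu xu] := near _ sd1; have [tv xv] := near _ sd2.
have ru := d1P t' x' t'T x'L tu xu; have rv := d2P t' x' t'T x'L tv xv.
move: ru rv.
have -> : t' - t = s * k by rewrite t'E addrAC subrr add0r.
have -> : x' - x = s * (k * lam) by rewrite x'E addrAC subrr add0r.
set ru := u t' x' - _ - _ - _; set rv := v t' x' - _ - _ - _ => Hu Hv.
have szB : `|s * k| + `|s * (k * lam)| <= s * B.
  by rewrite !normrM gtr0_norm // -sB lerD // ler_pM2l // ler_pM.
have {}Hu : `|ru| <= e1 * (s * B) by rewrite (le_trans Hu) // ler_pM2l.
have {}Hv : `|rv| <= e1 * (s * B) by rewrite (le_trans Hv) // ler_pM2l.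
have s0B : 0 < s * B by rewrite mulr_gt0.
have e1sB : e1 * (s * B) <= s * B by rewrite ler_piMl // ltW.
have incr (y' y p q r : 'cV[R]_n) : r = y' - y - (s * k) *: p - (s * (k * lam)) *: q ->
    `|p| <= 1 -> `|q| <= 1 -> `|r| <= e1 * (s * B) -> `|y' - y| <= 2 * (s * B).
  move=> rE p1 q1 rB.
  have -> : y' - y = r + ((s * k) *: p + (s * (k * lam)) *: q).
    by rewrite rE; apply/matrixP => j j'; rewrite !mxE; ring.
  rewrite (le_trans (ler_normD _ _)) //.
  have : `|(s * k) *: p + (s * (k * lam)) *: q| <= s * B.
    rewrite (le_trans (ler_normD _ _)) // (le_trans _ szB) // !(normrZ _ p) !(normrZ _ q).
    by rewrite lerD // ler_piMr.
  by lra.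
have du' := incr _ _ _ _ _ erefl pu1 qu1 Hu.
have dv' := incr _ _ _ _ _ erefl pv1 qv1 Hv.
set W := `|u t x - v t x|.
have W0 : 0 <= W by exact: normr_ge0.
have w'W : `|u t' x' - v t' x'| <= W + 4 * (s * B).
  have -> : u t' x' - v t' x' = (u t x - v t x) + ((u t' x' - u t x) - (v t' x' - v t x)).
    by apply/matrixP => j j'; rewrite !mxE; ring.
  rewrite (le_trans (ler_normD _ _)) // lerD // (le_trans (ler_normB _ _)) //; lra.
set lu := l i (u t x); set lv := l i (v t x); set lu' := l i (u t' x').
set fu := f i (u t x) in eu; set fv := f i (v t x) in ev.
set lamv := lambda i (v t x) in ev.
have lamvc : `|lamv| <= c by exact: lambda_le.
pose E1 := fu - fv; pose E2 := pairing (lv - lu) (pv + lamv *: qv).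
pose E3 := pairing lu ((lamv - lam) *: qv).
pose E4 := pairing lu (ru - rv).
pose E5 := pairing (lu' - lu) (u t' x' - v t' x').
(* E4 collects the remainders of the two expansions, E1 + E2 + E3 is what is left
of the equation of u once that of v is subtracted, and E5 is due to the
variation of l_i(u). *)
have -> : pairing lu' (u t' x' - v t' x') - pairing lu (u t x - v t x) =
    E4 + s * k * (E1 + E2 + E3) + E5.
  rewrite /E1 /E2 /E3 /E4 /E5 -eu -ev /ru /rv.
  rewrite !(pairingBl, pairingBr, pairingDr, pairingZr); ring.
have W' : `|v t x - u t x| = W by rewrite distrC.
have E1le : `|E1| <= c * W by exact: f_lip.
have E2le : `|E2| <= n%:R * (c * W) * (1 + c).
  apply: pairing_bound; first by rewrite -W'; exact: l_lip.
  rewrite (le_trans (ler_normD _ _)) // lerD // normrZ -[leRHS]mulr1 ler_pM //.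
have E3le : `|E3| <= n%:R * c * (c * W).
  apply: pairing_bound; first exact: l_le.
  rewrite normrZ -[leRHS]mulr1 ler_pM // -W'; exact: lambda_lip.
have E4le : `|E4| <= n%:R * c * (2 * (e1 * (s * B))).
  apply: pairing_bound; first exact: l_le.
  rewrite (le_trans (ler_normB _ _)) //; lra.
have E5le : `|E5| <= n%:R * (c * (2 * (s * B))) * (W + 4 * (s * B)).
  apply: pairing_bound => //; rewrite (le_trans (l_lip i usm u'sm)) //.
  by rewrite ler_pM2l.
have E123 : `|s * k * (E1 + E2 + E3)| <=
    s * k0 * (c * W + n%:R * (c * W) * (1 + c) + n%:R * c * (c * W)).
  rewrite normrM ler_pM //; first by rewrite normrM gtr0_norm // ler_pM2l.
  rewrite (le_trans (ler_normD _ _)) // lerD // (le_trans (ler_normD _ _)) //.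
  exact: lerD.
have slast : 8 * (n%:R * c) * B * B * s <= e / 2.
  apply: (@le_trans _ _ ((8 * (n%:R * c) * B * B + 1) * s)).
    by rewrite ler_wpM2r ?(ltW s0) // lerDl.
  by rewrite mulrC -ler_pdivlMr // ltW.
apply: (@le_trans _ _ (n%:R * c * (2 * (e1 * (s * B))) +
  s * k0 * (c * W + n%:R * (c * W) * (1 + c) + n%:R * c * (c * W)) +
  n%:R * (c * (2 * (s * B))) * (W + 4 * (s * B)))).
  by rewrite (le_trans (ler_normD _ _)) // lerD // (le_trans (ler_normD _ _)) // lerD.
have -> : n%:R * c * (2 * (e1 * (s * B))) +
  s * k0 * (c * W + n%:R * (c * W) * (1 + c) + n%:R * c * (c * W)) +
  n%:R * (c * (2 * (s * B))) * (W + 4 * (s * B)) =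
  s * (K * W + (2 * (n%:R * c) * B * e1 + 8 * (n%:R * c) * B * B * s)).
  by rewrite /K; ring.
by rewrite ler_pM2l // lerD2l (splitr e) lerD.
Qed.

Lemma char_solution_continuous T L u t x e :
  char_solution T L u -> t \in `[0, T] -> x \in `[0, L] -> 0 < e ->
  exists2 d, 0 < d & forall t' x', t' \in `[0, T] -> x' \in `[0, L] ->
    `|t' - t| < d -> `|x' - x| < d -> `|u t' x' - u t x| <= e.
Proof.
move=> usol tT xL e0; have [_ [p [q [p1 q1 du _]]]] := usol t x tT xL.
have [d d0 dP] := du 1 ltr01.
exists (Num.min d (e / 4)); first by rewrite lt_min d0 divr_gt0.
move=> t' x' t'T x'L; rewrite !lt_min => /andP[td te] /andP[xd xe].
have := dP t' x' t'T x'L td xd; rewrite mul1r; set r := _ - _ - _ - _ => rP.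
have -> : u t' x' - u t x = r + ((t' - t) *: p + (x' - x) *: q).
  by rewrite /r; apply/matrixP => j j'; rewrite !mxE; ring.
rewrite (le_trans (ler_normD _ _)) //.
have H : `|(t' - t) *: p + (x' - x) *: q| <= `|t' - t| + `|x' - x|.
  by rewrite (le_trans (ler_normD _ _)) // !(normrZ _ p) !(normrZ _ q) lerD // ler_piMr.
lra.
Qed.

Definition char_mx (a : 'cV[R]_n) : 'M[R]_n := \matrix_(i < n) l i a.

Lemma char_mxE a w i : (char_mx a *m w) i 0 = pairing (l i a) w.
Proof. by rewrite /pairing !mxE; apply: eq_bigr => j _; rewrite mxE. Qed.

Context (mu : R) (mu0 : 0 < mu).
Context (lambda_ge : forall i a, `|a| < c^-1 -> 1 <= mu * `|lambda i a|).
Context (char_mx_inv : forall a w : 'cV[R]_n, `|a| < c^-1 ->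
  `|w| <= c * `|char_mx a *m w|).

Lemma char_norm_continuous T L (u v : R -> R -> 'cV[R]_n) (D : set (R * R)) :
  char_solution T L u -> char_solution T L v ->
  (forall t x, D (t, x) -> t \in `[0, T] /\ x \in `[0, L]) ->
  {within D, continuous (fun P : R * R =>
    `|char_mx (u P.1 P.2) *m (u P.1 P.2 - v P.1 P.2)|)}.
Proof.
move=> usol vsol Dsub; apply/within_continuousP => -[t x] Dtx e e0 /=.
have [tT xL] := Dsub _ _ Dtx.
have [usm _] := usol t x tT xL.
pose C := 4 * n%:R + 2 * n%:R * c + 1.
have C0 : 0 < C by rewrite ltr_wpDl // addr_ge0 // !mulr_ge0 // ltW.
have eC : 0 < e / C by rewrite divr_gt0.
have [d1 d10 d1P] := char_solution_continuous usol tT xL eC.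
have [d2 d20 d2P] := char_solution_continuous vsol tT xL eC.
exists (Num.min d1 d2); first by rewrite lt_min d10.
move=> [t' x'] Dtx'; have [t'T x'L] := Dsub _ _ Dtx'.
rewrite [ltLHS]/Num.norm/= gt_max /= !lt_min !(distrC _ t') !(distrC _ x').
move=> /andP[/andP[t1 t2] /andP[x1 x2]].
have {d1P}du := d1P t' x' t'T x'L t1 x1.
have {d2P}dv := d2P t' x' t'T x'L t2 x2.
have [u'sm _] := usol t' x' t'T x'L.
have [v'sm _] := vsol t' x' t'T x'L.
rewrite distrC (le_trans (ler_dist_dist _ _)) //; apply: mx_norm_le.
  exact: ltW.
move=> i j; rewrite (ord1 j) mxE [X in _ + X]mxE !char_mxE.
set lu := l i (u t x); set lu' := l i (u t' x').
set w := u t x - v t x; set w' := u t' x' - v t' x'.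
have -> : pairing lu' w' - pairing lu w = pairing (lu' - lu) w' + pairing lu (w' - w).
  by rewrite pairingBl pairingBr addrA subrK.
have w'le : `|w'| <= 2 * c^-1.
  by rewrite (le_trans (ler_normB _ _)) //; lra.
have dw : `|w' - w| <= 2 * (e / C).
  have -> : w' - w = (u t' x' - u t x) - (v t' x' - v t x).
    by apply/matrixP => k k'; rewrite !mxE; ring.
  by rewrite (le_trans (ler_normB _ _)) //; lra.
have dl : `|lu' - lu| <= c * (e / C).
  by rewrite (le_trans (l_lip i usm u'sm)) // ler_pM2l.
have H1 := pairing_bound dl w'le.
have H2 := pairing_bound (l_le i usm) dw.
rewrite (le_trans (ler_normD _ _)) // (le_trans (lerD H1 H2)) //.
have -> : n%:R * (c * (e / C)) * (2 * c^-1) + n%:R * c * (2 * (e / C)) =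
    (2 * n%:R + 2 * n%:R * c) * (e / C) by field; rewrite !gt_eqF.
apply: (@le_trans _ _ (C * (e / C))); last by rewrite mulrC divfK // gt_eqF.
rewrite ler_wpM2r ?(ltW eC) // /C.
have := ler0n R n; lra.
Qed.

(** The maximum principle is applied to the sup norm of the characteristic
    components l_i(u) w of the difference w: at a maximum only the component of
    largest modulus matters, and it is followed along its own characteristic. *)
Lemma weighted_propagation (k0 b : R) : 0 < k0 -> 0 <= b -> exists2 C, 0 < C &
  forall T L (u v : R -> R -> 'cV[R]_n) (D : set (R * R)) (p : R -> R -> R) M,
  char_solution T L u -> char_solution T L v -> compact D ->
  (forall t x, D (t, x) -> t \in `[0, T] /\ x \in `[0, L]) ->
  continuous (fun P : R * R => p P.1 P.2) -> 0 <= M ->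
  (forall t x, D (t, x) -> 0 <= p t x <= b) ->
  (forall t x, D (t, x) -> `|u t x - v t x| <= M \/
     forall i, exists2 k, `|k| <= k0 & exists2 d, 0 < d &
       forall s t' x', 0 < s -> s < d ->
         t' = t + s * k -> x' = x + s * (k * lambda i (u t x)) ->
         D (t', x') /\ p t x + s <= p t' x') ->
  forall t x, D (t, x) -> `|u t x - v t x| <= C * M.
Proof.
move=> k00 b0; have [K K0 KP] := char_increment k00.
have nc : 0 <= n%:R * c by rewrite mulr_ge0 ?ler0n // ltW.
exists (c * (n%:R * c * expR ((K * c + 1) * b)) + 1).
  by rewrite ltr_wpDl // !mulr_ge0 ?expR_ge0 // ?ler0n // ltW.
move=> T L u v D p M usol vsol cD Dsub cp M0 pb step t x Dtx.
pose N (P : R * R) := `|char_mx (u P.1 P.2) *m (u P.1 P.2 - v P.1 P.2)|.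
have cN : {within D, continuous N} by exact: (char_norm_continuous usol vsol).
have [tT xL] := Dsub _ _ Dtx; have [usm _] := usol t x tT xL.
suff NM : N (t, x) <= n%:R * c * M * expR ((K * c + 1) * (b - 0)).
  rewrite (le_trans (char_mx_inv _ usm)) // mulrDl mul1r ler_wpDr //.
  by rewrite -[leRHS]mulrA ler_pM2l // (le_trans NM) // subr0 [leLHS]mulrAC.
apply: (max_principle (p := fun P => p P.1 P.2) cD cN) => //.
- exact: continuous_subspaceT.
- by rewrite mulr_ge0.
- by rewrite mulr_ge0 // ltW.
- by case=> t1 x1 /pb.
move=> [t1 x1] D1 {t x Dtx tT xL usm}.
have [tT xL] := Dsub _ _ D1; have [usm _] := usol t1 x1 tT xL.
have [wM|dir] := step _ _ D1.
  left; apply: mx_norm_le; first by rewrite mulr_ge0.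
  move=> i j; rewrite (ord1 j) char_mxE; apply: pairing_bound => //.
  exact: l_le.
have [N0|[i Ni]] := cV_norm_attained (char_mx (u t1 x1) *m (u t1 x1 - v t1 x1)).
  by left; rewrite /N /= N0 mulr_ge0.
right=> e r e0 r0; have [k kk0 [d1 d10 d1P]] := dir i.
have [d2 d20 d2P] := KP T L u v t1 x1 i k e usol vsol tT xL kk0 e0.
pose s := Num.min (r / 2) (Num.min (d1 / 2) (d2 / 2)).
have s0 : 0 < s by rewrite !lt_min !divr_gt0.
have h1 : s <= r / 2 by rewrite !ge_min lexx.
have h2 : s <= d1 / 2 by rewrite !ge_min lexx !orbT.
have h3 : s <= d2 / 2 by rewrite !ge_min lexx !orbT.
exists s; first by rewrite s0 /=; lra.
have sd1 : s < d1 by lra.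
have sd2 : s < d2 by lra.
have [DQ pQ] := d1P s _ _ s0 sd1 erefl erefl.
set t' := t1 + _ in DQ pQ; set x' := x1 + _ in DQ pQ.
exists (t', x') => //; split => //.
have [t'T x'L] := Dsub _ _ DQ.
have := d2P s t' x' s0 sd2 erefl erefl t'T x'L.
rewrite -!char_mxE => H.
have NQ : `|(char_mx (u t' x') *m (u t' x' - v t' x')) i 0| <= N (t', x').
  exact: mx_entry_le.
have wN : `|u t1 x1 - v t1 x1| <= c * N (t1, x1) by exact: char_mx_inv.
have NE : N (t1, x1) = `|(char_mx (u t1 x1) *m (u t1 x1 - v t1 x1)) i 0| by [].
rewrite lerBlDr (le_trans _ (lerD NQ (lexx _))) // NE -lerBlDl.
rewrite distrC in H; rewrite (le_trans (lerB_dist _ _)) // (le_trans H) //.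
by rewrite ler_pM2l // lerD2r -mulrA ler_wpM2l // -NE.
Qed.

(** Propagation from one end of the interval, with x as the evolution variable:
    y := z + sg * x is the distance to that end, and the region of determinacy
    is bounded by lines of slope mu, which no backward characteristic crosses. *)
Lemma lateral_propagation L : 0 < L -> exists2 C, 0 < C &
  forall T (u v : R -> R -> 'cV[R]_n) M z sg,
  char_solution T L u -> char_solution T L v -> 0 <= M ->
  (forall t, t \in `[0, T] -> `|u t 0 - v t 0| <= M /\ `|u t L - v t L| <= M) ->
  (z = 0 /\ sg = 1) \/ (z = L /\ sg = - 1) ->
  forall t x, t \in `[0, T] -> x \in `[0, L] ->
    mu * (z + sg * x) <= t -> t <= T - mu * (z + sg * x) ->
    `|u t x - v t x| <= C * M.
Proof.
move=> L0; have [C C0 CP] := weighted_propagation mu0 (ltW L0).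
exists C => // T u v M z sg usol vsol M0 bd zsg t x tT xL ht1 ht2.
(* The rectangle cut by the two half-planes mu * y <= t and t <= T - mu * y. *)
pose D : set (R * R) := (`[0, T]%classic `*` `[0, L]%classic)
  `&` [set P | 0 <= 1 * P.1 + (- mu * sg) * P.2 + (- mu * z)]
  `&` [set P | 0 <= (- 1) * P.1 + (- mu * sg) * P.2 + (T - mu * z)].
have DE t' x' : D (t', x') <-> [/\ t' \in `[0, T], x' \in `[0, L],
    mu * (z + sg * x') <= t' & t' <= T - mu * (z + sg * x')].
  rewrite /D /=; split=> [[[[h1 h2] h3] h4]|[h1 h2 h3 h4]].
    by split=> //; lra.
  by split; first split=> //; lra.
have cD : compact D.
  apply/compact_halfplane/compact_halfplane/compact_setX; exact: segment_compact.
apply: (CP T L u v D (fun _ x => L - (z + sg * x)) M) => //.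
- by move=> t' x' /DE[].
- have -> : (fun P : R * R => L - (z + sg * P.2)) =
      (fun P => 0 * P.1 + (- sg) * P.2 + (L - z)).
    by apply/funext => P; ring.
  exact: affine_continuous.
- move=> t' x' /DE[_]; rewrite in_itv /= => /andP[x0 xl] _ _.
  by case: zsg => -[-> ->]; apply/andP; split; lra.
- move=> t1 x1 /DE[t1T x1L h1 h2].
  have [y0|ypos] := leP (z + sg * x1) 0.
    left; have [b1 b2] := bd t1 t1T; move: x1L; rewrite in_itv/= => /andP[x0 xl].
    case: zsg => -[zE sgE]; rewrite zE sgE in y0.
      by have -> : x1 = 0 by lra.
    by have -> : x1 = L by lra.
  right=> i; have [usm _] := usol t1 x1 t1T x1L.
  set lam := lambda i (u t1 x1).
  have lamge : 1 <= mu * `|lam| by exact: lambda_ge.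
  have lam0 : lam != 0.
    by apply/eqP => lam0; move: lamge; rewrite lam0 normr0 mulr0 ler10.
  have kmu : `|- sg / lam| <= mu.
    have -> : `|- sg / lam| = `|lam|^-1.
      by rewrite normrM normfV normrN; case: zsg => -[_ ->];
        rewrite ?normrN normr1 mul1r.
    by rewrite -[leLHS]mul1r ler_pdivrMr ?normr_gt0.
  exists (- sg / lam) => //; exists (z + sg * x1) => // s t' x' s0 sy t'E.
  rewrite mulfVK // => x'E.
  have skm : `|s * (- sg / lam)| <= mu * s.
    by rewrite normrM gtr0_norm // mulrC ler_pM2r.
  move: skm; rewrite ler_norml => /andP[sk1 sk2].
  have yE : z + sg * x' = z + sg * x1 - s.
    by rewrite x'E; case: zsg => -[_ ->]; ring.
  split; last by rewrite yE; lra.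
  have ms : mu * s <= mu * (z + sg * x1) by rewrite ler_pM2l // ltW.
  move: t1T x1L; rewrite !in_itv/= => /andP[t0 tT1] /andP[x0 xl].
  apply/DE; rewrite yE mulrBr t'E; split; try lra.
    by rewrite in_itv/=; apply/andP; split; lra.
  rewrite in_itv/= x'E.
  by case: zsg sy => -[-> ->] sy; apply/andP; split; lra.
- exact/DE.
Qed.

(** Once the difference is controlled on the segment t = T / 2, which the two
    lateral regions of determinacy cover, it is propagated backwards in time
    down to t = 0; there every component is known at both ends. *)
Lemma backward_estimate Tm L : 0 < L -> 0 <= Tm -> exists2 C, 0 < C &
  forall T (u v : R -> R -> 'cV[R]_n) M,
  char_solution T L u -> char_solution T L v -> 0 <= M ->
  mu * L <= T -> T <= Tm ->
  (forall t, t \in `[0, T] -> `|u t 0 - v t 0| <= M /\ `|u t L - v t L| <= M) ->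
  forall x, x \in `[0, L] -> `|u 0 x - v 0 x| <= C * M.
Proof.
move=> L0 Tm0; have [C1 C10 P1] := lateral_propagation L0.
have [C2 C20 P2] := weighted_propagation ltr01 Tm0.
exists (C2 * (C1 + 1)); first by rewrite mulr_gt0 // addr_gt0.
move=> T u v M usol vsol M0 muL TTm bd x xL.
have muL0 : 0 < mu * L by rewrite mulr_gt0.
pose D : set (R * R) := `[0, T / 2]%classic `*` `[0, L]%classic.
have Dsub t' x' : D (t', x') -> t' \in `[0, T] /\ x' \in `[0, L].
  rewrite /D /= !in_itv/= => -[/andP[h1 h2] ->]; split=> //.
  by apply/andP; split; lra.
rewrite -mulrA; apply: (P2 T L u v D (fun t _ => t)) => //.
- by apply: compact_setX; exact: segment_compact.
- have -> : (fun P : R * R => P.1) = (fun P => 1 * P.1 + 0 * P.2 + 0).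
    by apply/funext => P; ring.
  exact: affine_continuous.
- by rewrite mulr_ge0 // addr_ge0 // ltW.
- move=> t' x' [/=]; rewrite in_itv/= => /andP[h1 h2] _.
  by apply/andP; split; lra.
- move=> t1 x1 D1; have [t1T x1L] := Dsub _ _ D1.
  have MM : M <= (C1 + 1) * M by rewrite ler_peMl // lerDr ltW.
  have [b1 b2] := bd _ t1T; have [usm _] := usol t1 x1 t1T x1L.
  case: D1 => /=; rewrite !in_itv/= => /andP[t0 t2] /andP[x0 xl].
  have [x10|x10] := leP x1 0.
    by left; rewrite (_ : x1 = 0) ?(le_trans b1) //; lra.
  have [x1l|x1l] := leP L x1.
    by left; rewrite (_ : x1 = L) ?(le_trans b2) //; lra.
  have [t1e|t1e] := leP (T / 2) t1.
    left; have t1E : t1 = T / 2 by lra.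
    have C1M : C1 * M <= (C1 + 1) * M by rewrite ler_wpM2r // lerDl.
    apply: le_trans C1M; have [xh|xh] := leP x1 (L / 2).
      have mx : mu * x1 <= mu * (L / 2) by rewrite ler_pM2l.
      by apply: (P1 T u v M 0 1) => //; [left | lra | lra].
    have mx : mu * (L / 2) < mu * x1 by rewrite ltr_pM2l.
    by apply: (P1 T u v M L (- 1)) => //; [right | lra | lra].
  right=> i; exists 1; first by rewrite normr1.
  exists (Num.min (T / 2 - t1) (Num.min (x1 / c) ((L - x1) / c))).
    by rewrite !lt_min subr_gt0 t1e !divr_gt0 // subr_gt0.
  move=> s t' x' s0; rewrite !lt_min !ltr_pdivlMr // => /andP[s1 /andP[s2 s3]].
  rewrite mulr1 mul1r => -> ->; split; last by [].
  have slam : `|s * lambda i (u t1 x1)| <= s * c.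
    by rewrite normrM gtr0_norm // ler_pM2l // lambda_le.
  move: slam; rewrite ler_norml => /andP[sl1 sl2].
  by rewrite /D /= !in_itv/=; split; apply/andP; split; lra.
- by rewrite /D /= !in_itv/= in xL *; split=> //; apply/andP; split; lra.
Qed.

End Difference.

(** * Uniform constants near the zero state *)

Lemma near_pinfty_ex (R : realType) (P : R -> Prop) :
  (\forall c \near +oo, P c) -> exists2 c : R, 0 < c & P c.
Proof.
move=> [N [_ NP]]; exists (`|N| + 1); first by rewrite ltr_wpDl.
by apply: NP; rewrite (le_lt_trans (ler_norm _)) // ltrDl.
Qed.

Section NearZero.
Context {R : realType} {n : nat}.
Implicit Types a b w : 'cV[R]_n.

(** Properties of small states are stated for all large c, the radius being
    c^-1: finitely many of them then hold for a common c. *)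
Lemma near_pinfty_le2 (X Y : 'cV[R]_n -> 'cV[R]_n -> R) k : 0 < k ->
  (forall a b, 0 <= Y a b) ->
  (forall a b, `|a| < k^-1 -> `|b| < k^-1 -> X a b <= k * Y a b) ->
  \forall c \near +oo, forall a b, `|a| < c^-1 -> `|b| < c^-1 ->
    X a b <= c * Y a b.
Proof.
move=> k0 Y0 H; near=> c; move=> a b ac bc.
have kc : k <= c by near: c; apply: nbhs_pinfty_ge; rewrite num_real.
apply: (@le_trans _ _ (k * Y a b)); last by rewrite ler_wpM2r.
by apply: H; [exact: lt_inv_le ac | exact: lt_inv_le bc].
Unshelve. all: by end_near. Qed.

Lemma near_pinfty_small r : 0 < r ->
  \forall c \near +oo, forall a, `|a| < c^-1 -> `|a| < r.
Proof.
move=> r0; near=> c; move=> a ac; rewrite -(invrK r).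
have rc : r^-1 <= c by near: c; apply: nbhs_pinfty_ge; rewrite num_real.
by apply: (lt_inv_le _ rc ac); rewrite invr_gt0.
Unshelve. all: by end_near. Qed.

Context (l : 'I_n -> 'cV[R]_n -> 'rV[R]_n) (k : R) (k0 : 0 < k).
Context (l_lip : forall i a b, `|a| < k^-1 -> `|b| < k^-1 ->
  `|l i b - l i a| <= k * `|b - a|).

Lemma char_mx_lipschitz a b : `|a| < k^-1 -> `|b| < k^-1 ->
  `|char_mx l b - char_mx l a| <= k * `|b - a|.
Proof.
move=> ak bk; apply: mx_norm_le => [|i j]; first by rewrite mulr_ge0 // ltW.
have -> : (char_mx l b - char_mx l a) i j = (l i b - l i a) 0 j by rewrite !mxE.
by rewrite (le_trans (mx_entry_le _ _ _)) // l_lip.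
Qed.

(** The matrix of left eigenvectors is invertible at 0 and varies little. *)
Lemma char_mx_coercive : row_free (char_mx l 0) ->
  \forall c \near +oo, forall a w, `|a| < c^-1 -> `|w| <= c * `|char_mx l a *m w|.
Proof.
rewrite row_free_unit => Lunit.
have [kap kap0 kapP] : exists2 kap : R, 0 < kap &
    forall w, `|w| <= kap * `|char_mx l 0 *m w|.
  exists (n%:R * `|invmx (char_mx l 0)| + 1).
    by rewrite ltr_wpDl // mulr_ge0 // ler0n.
  move=> w; rewrite -{1}(mulKmx Lunit w) (le_trans (mulmx_norm_le _ _)) //.
  by rewrite ler_wpM2r // lerDl.
pose N : R := 2 * kap + k + 2 * kap * n%:R * k.
have X0 : 0 <= 2 * kap * n%:R * k by rewrite !mulr_ge0 ?ler0n // ltW.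
have kpos : 0 < k by exact: k0.
have Npos : 0 < N by rewrite /N; lra.
have kN : k <= N by rewrite /N; lra.
have kapN : 2 * kap <= N by rewrite /N; lra.
have XN : 2 * kap * n%:R * k <= N by rewrite /N; lra.
near=> c; move=> a w ac.
have Nc : N <= c by near: c; apply: nbhs_pinfty_ge; rewrite num_real.
have c0 : 0 < c by exact: lt_le_trans Nc.
have kc : k <= c by exact: le_trans Nc.
have ak := lt_inv_le k0 kc ac.
have zk : `|0 : 'cV[R]_n| < k^-1 by rewrite normr0 invr_gt0.
have h1 := kapP w.
have h2 : `|(char_mx l a - char_mx l 0) *m w| <= n%:R * (k * `|a|) * `|w|.
  rewrite (le_trans (mulmx_norm_le _ _)) // ler_wpM2r // ler_wpM2l ?ler0n //.
  by have := char_mx_lipschitz zk ak; rewrite subr0.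
have h3 : `|char_mx l 0 *m w| <= `|char_mx l a *m w| + n%:R * (k * `|a|) * `|w|.
  have -> : char_mx l 0 *m w = char_mx l a *m w - (char_mx l a - char_mx l 0) *m w.
    by rewrite mulmxBl opprB addrC subrK.
  by rewrite (le_trans (ler_normB _ _)) // lerD2l.
have h4 : 2 * kap * n%:R * k * `|a| <= 1.
  apply: (@le_trans _ _ (c * `|a|)); last first.
    by rewrite -ler_pdivlMl // mulr1 ltW.
  by rewrite ler_wpM2r // (le_trans XN).
have h5 : 2 * kap * n%:R * k * `|a| * `|w| <= `|w| by rewrite ler_piMl.
have h6 : kap * `|char_mx l 0 *m w| <=
    kap * `|char_mx l a *m w| + kap * (n%:R * (k * `|a|) * `|w|).
  by rewrite -mulrDr ler_pM2l.
have h7 : `|w| <= 2 * kap * `|char_mx l a *m w|.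
  have : kap * (n%:R * (k * `|a|) * `|w|) = 2^-1 * (2 * kap * n%:R * k * `|a| * `|w|).
    by field.
  by lra.
by rewrite (le_trans h7) // ler_wpM2r // (le_trans kapN).
Unshelve. all: by end_near. Qed.

Lemma char_var_sub i a b : char_var l i b - char_var l i a =
  pairing (l i b) (b - a) + pairing (l i b - l i a) a.
Proof. by rewrite pairingBr pairingBl /pairing /char_var; ring. Qed.

Lemma char_var_lipschitz i a b : `|a| < k^-1 -> `|b| < k^-1 ->
  `|l i b| <= k ->
  `|char_var l i b - char_var l i a| <= n%:R * (k + 1) * `|b - a|.
Proof.
move=> ak bk lk; rewrite char_var_sub (le_trans (ler_normD _ _)) //.
have H1 := @pairing_bound _ _ _ (b - a) _ _ lk (lexx _).
have H2 := pairing_bound (l_lip i ak bk) (ltW ak).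
rewrite (le_trans (lerD H1 H2)) //.
have -> : n%:R * (k * `|b - a|) * k^-1 = n%:R * `|b - a|.
  by field; rewrite gt_eqF.
lra.
Qed.

(** The map u |-> v = l(u) u has the invertible derivative l(0) at the origin,
    hence is bi-Lipschitz near it. *)
Lemma char_coords_coercive : row_free (char_mx l 0) ->
  \forall c \near +oo, forall a b, `|a| < c^-1 -> `|b| < c^-1 ->
    `|b - a| <= c * `|char_mx l b *m b - char_mx l a *m a|.
Proof.
move=> /char_mx_coercive/near_pinfty_ex[K K0 KP].
pose N : R := 2 * K + k + 2 * K * n%:R * k.
have K1 : K <= 2 * K by lra.
have X0 : 0 <= 2 * K * n%:R * k by rewrite !mulr_ge0 ?ler0n // ltW.
have kpos : 0 < k by exact: k0.
have Npos : 0 < N by rewrite /N; lra.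
have kN : k <= N by rewrite /N; lra.
have KN : 2 * K <= N by rewrite /N; lra.
have XN : 2 * K * n%:R * k <= N by rewrite /N; lra.
near=> c; move=> a b ac bc.
have Nc : N <= c by near: c; apply: nbhs_pinfty_ge; rewrite num_real.
have c0 : 0 < c by exact: lt_le_trans Nc.
have kc : k <= c by exact: le_trans Nc.
have Kc : K <= c by exact: le_trans (le_trans K1 KN) Nc.
have h1 := KP b (b - a) (lt_inv_le K0 Kc bc).
have h2 : `|char_mx l b *m (b - a)| <=
    `|char_mx l b *m b - char_mx l a *m a| + n%:R * (k * `|b - a|) * `|a|.
  have -> : char_mx l b *m (b - a) = (char_mx l b *m b - char_mx l a *m a)
      - (char_mx l b - char_mx l a) *m a.
    by rewrite mulmxBr mulmxBl opprB addrA subrK.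
  rewrite (le_trans (ler_normB _ _)) // lerD2l (le_trans (mulmx_norm_le _ _)) //.
  rewrite ler_wpM2r // ler_wpM2l ?ler0n // char_mx_lipschitz //.
    exact: lt_inv_le ac.
  exact: lt_inv_le bc.
have h4 : 2 * K * n%:R * k * `|a| <= 1.
  apply: (@le_trans _ _ (c * `|a|)); last first.
    by rewrite -ler_pdivlMl // mulr1 ltW.
  by rewrite ler_wpM2r // (le_trans XN).
have h5 : 2 * K * n%:R * k * `|a| * `|b - a| <= `|b - a| by rewrite ler_piMl.
have h6 : K * `|char_mx l b *m (b - a)| <=
    K * `|char_mx l b *m b - char_mx l a *m a| + K * (n%:R * (k * `|b - a|) * `|a|).
  by rewrite -mulrDr ler_pM2l.
have h7 : `|b - a| <= 2 * K * `|char_mx l b *m b - char_mx l a *m a|.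
  have : K * (n%:R * (k * `|b - a|) * `|a|) =
      2^-1 * (2 * K * n%:R * k * `|a| * `|b - a|) by field.
  by lra.
by rewrite (le_trans h7) // ler_wpM2r // (le_trans KN).
Unshelve. all: by end_near. Qed.

End NearZero.

Section Families.
Context {R : realType} {n : nat} {W : normedModType R} (U : set 'cV[R]_n).
Context (g : 'I_n -> 'cV[R]_n -> W).
Context (oU : open U) (U0 : U 0) (g_C1 : forall i, C1_open U (g i)).

Lemma C1_family_lipschitz : \forall c \near +oo, forall i a b,
  `|a| < c^-1 -> `|b| < c^-1 -> `|g i b - g i a| <= c * `|b - a|.
Proof.
have H i : \forall c \near +oo, forall a b : 'cV[R]_n,
    `|a| < c^-1 -> `|b| < c^-1 -> `|g i b - g i a| <= c * `|b - a|.
  have [k k0 kP] := C1_open_lipschitz oU U0 (g_C1 i).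
  apply: (near_pinfty_le2 k0) => [a b|a b ak bk]; first exact: normr_ge0.
  by have [] := kP a b ak bk.
by near=> c; move=> i; move: i; near: c; exact: filter_forall.
Unshelve. all: by end_near. Qed.

Lemma C1_family_bounded : \forall c \near +oo, forall i a,
  `|a| < c^-1 -> `|g i a| <= c.
Proof.
have [k k0 kP] := near_pinfty_ex C1_family_lipschitz.
pose S := \sum_i `|g i 0| + 1.
near=> c; move=> i a ac.
have kc : k <= c by near: c; apply: nbhs_pinfty_ge; rewrite num_real.
have Sc : S <= c by near: c; apply: nbhs_pinfty_ge; rewrite num_real.
have ak := lt_inv_le k0 kc ac.
have zk : `|0 : 'cV[R]_n| < k^-1 by rewrite normr0 invr_gt0.
rewrite (le_trans _ Sc) // -(subrK (g i 0) (g i a)) (le_trans (ler_normD _ _)) //.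
rewrite addrC lerD //; first by rewrite (bigD1 i) //= lerDl sumr_ge0.
rewrite (le_trans (kP i 0 a zk ak)) // subr0 -ler_pdivlMl // mulr1.
exact: ltW.
Unshelve. all: by end_near. Qed.

End Families.

(** Near 0 no characteristic is slower than 1 / mu. *)
Lemma C1_family_lower_bound (R : realType) (n : nat) (U : set 'cV[R]_n)
    (g : 'I_n -> 'cV[R]_n -> R) mu : open U -> U 0 -> 0 < mu ->
  (forall i, C1_open U (g i)) -> (forall i, 1 < mu * `|g i 0|) ->
  \forall c \near +oo, forall i a, `|a| < c^-1 -> 1 <= mu * `|g i a|.
Proof.
move=> oU U0 mu0 g_C1 g0.
have [k k0 kP] := near_pinfty_ex (C1_family_lipschitz oU U0 g_C1).
suff H i : \forall c \near +oo, forall a : 'cV[R]_n,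
    `|a| < c^-1 -> 1 <= mu * `|g i a|.
  by near=> c; move=> i; move: i; near: c; exact: filter_forall.
pose r := (mu * `|g i 0| - 1) / (mu * k).
have muk : 0 < mu * k by rewrite mulr_gt0.
have r0 : 0 < r by rewrite divr_gt0 // subr_gt0.
near=> c; move=> a ac.
have kc : k <= c by near: c; apply: nbhs_pinfty_ge; rewrite num_real.
have ak := lt_inv_le k0 kc ac.
have zk : `|0 : 'cV[R]_n| < k^-1 by rewrite normr0 invr_gt0.
have ar : `|a| < r by move: a ac {ak}; near: c; exact: near_pinfty_small.
have h1 : `|g i 0| <= `|g i a| + k * `|a|.
  have -> : g i 0 = g i a - (g i a - g i 0) by rewrite opprB addrC subrK.
  rewrite (le_trans (ler_normB _ _)) // lerD2l.
  by rewrite (le_trans (kP i 0 a zk ak)) // subr0.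
have h2 : mu * `|g i 0| <= mu * `|g i a| + mu * k * `|a|.
  by rewrite -mulrA -mulrDr ler_pM2l.
have h3 : mu * k * `|a| <= mu * `|g i 0| - 1.
  by rewrite mulrC -ler_pdivlMr // ltW.
lra.
Unshelve. all: by end_near. Qed.

Lemma char_var0 (R : realType) (n : nat) (l : 'I_n -> 'cV[R]_n -> 'rV[R]_n) i :
  char_var l i 0 = 0.
Proof. by rewrite /char_var mulmx0 mxE. Qed.

(** * Competitors of a solution *)

Section Solutions.
Context {R : realType} {n : nat}.
Context (l : 'I_n -> 'cV[R]_n -> 'rV[R]_n) (lambda : 'I_n -> 'cV[R]_n -> R).
Context (f : 'I_n -> 'cV[R]_n -> R) (c : R).
Let sol := char_solution l lambda f c.

Lemma char_solution_shift T L h u : 0 <= h -> sol T L u ->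
  sol (T - h) L (fun t => u (t + h)).
Proof.
move=> h0 usol t x; rewrite in_itv/= => /andP[t0 tT] xL.
have thT : t + h \in `[0, T] by rewrite in_itv/=; apply/andP; split; lra.
have [usm [p [q [p1 q1 du eu]]]] := usol _ _ thT xL.
split=> //; exists p, q; split=> // e e0; have [d d0 dP] := du e e0.
exists d => // t' x' t'T x'L; have := dP (t' + h) x'.
have -> : t' + h - (t + h) = t' - t by ring.
apply=> //; move: t'T; rewrite /= !in_itv/= => /andP[t'0 t'T].
by apply/andP; split; lra.
Qed.

Lemma char_solution_restrict T T' L u : T' <= T -> sol T L u -> sol T' L u.
Proof.
move=> TT usol.
have sub t : t \in `[0, T'] -> t \in `[0, T].
  by rewrite !in_itv/= => /andP[-> /le_trans->].
move=> t x tT xL; have [usm [p [q [p1 q1 du eu]]]] := usol _ _ (sub _ tT) xL.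
split=> //; exists p, q; split=> // e e0; have [d d0 dP] := du e e0.
by exists d => // t' x' t'T x'L; apply: dP => //; exact: sub.
Qed.

Lemma char_solution0 T L : 0 < c -> (forall i, f i 0 = 0) ->
  sol T L (fun _ _ => 0).
Proof.
move=> c0 f0 t x tT xL; rewrite normr0 invr_gt0; split=> //.
exists 0, 0; rewrite normr0; split=> //.
  move=> e e0; exists 1 => // t' x' _ _ _ _.
  by rewrite !scaler0 !subr0 normr0 mulr_ge0 ?addr_ge0 // ltW.
by move=> i; rewrite pairingDr !pairingZr f0 /pairing mulmx0 mxE mulr0 addr0.
Qed.

End Solutions.

(** * From the observations to the initial data *)

Section Observability.
Context {R : realType} {n m : nat} (L T mu c dl : R).
Context (U V : set 'cV[R]_n).
Context (B : 'cV[R]_n -> 'cV[R]_n).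
Context (l : 'I_n -> 'cV[R]_n -> 'rV[R]_n) (lambda : 'I_n -> 'cV[R]_n -> R).
Context (G : 'I_n -> R -> 'cV[R]_n -> R).
Context (L0 : 0 < L) (mu0 : 0 < mu) (muLT : mu * L < T) (c0 : 0 < c).
Context (dl1 : dl <= 1) (dlc : dl < c^-1).
Context (dlV : n%:R * (c + 1) * dl < c^-1).
Context (l_lip : forall i a b, `|a| < c^-1 -> `|b| < c^-1 ->
  `|l i b - l i a| <= c * `|b - a|).
Context (lambda_lip : forall i a b, `|a| < c^-1 -> `|b| < c^-1 ->
  `|lambda i b - lambda i a| <= c * `|b - a|).
Context (f_lip : forall i a b, `|a| < c^-1 -> `|b| < c^-1 ->
  `|source B l i b - source B l i a| <= c * `|b - a|).
Context (l_le : forall i a, `|a| < c^-1 -> `|l i a| <= c).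
Context (lambda_le : forall i a, `|a| < c^-1 -> `|lambda i a| <= c).
Context (lambda_ge : forall i a, `|a| < c^-1 -> 1 <= mu * `|lambda i a|).
Context (char_mx_inv : forall a w : 'cV[R]_n, `|a| < c^-1 ->
  `|w| <= c * `|char_mx l a *m w|).
Context (coords_inv : forall a b : 'cV[R]_n, `|a| < c^-1 -> `|b| < c^-1 ->
  `|b - a| <= c * `|char_mx l b *m b - char_mx l a *m a|).
Context (G_incr : forall i t t' a b, t \in `[0, T] -> t' \in `[0, T] ->
  `|a| < c^-1 -> `|b| < c^-1 ->
  `|G i t' b - G i t a| <= c * (`|b - a| + `|a| * `|t' - t|)).
Context (l_diff : forall i a, U a -> differentiable (l i) a).
Context (f0 : forall i, source B l i 0 = 0).
Context (G0 : forall i t, t \in `[0, T] -> G i t 0 = 0).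

Let sol := char_solution l lambda (source B l) c.

Let T0 : 0 < T.
Proof. by rewrite (le_lt_trans _ muLT) // mulr_ge0 // ltW. Qed.

Lemma left_end : 0 \in `[0, L]. Proof. by rewrite in_itv/= lexx ltW. Qed.
Lemma right_end : L \in `[0, L]. Proof. by rewrite in_itv/= lexx ltW. Qed.
Lemma x_out_itv (i : 'I_n) : x_out m L i \in `[0, L].
Proof. by rewrite /x_out; case: ifP => _; [exact: left_end|exact: right_end]. Qed.

(** At each end every characteristic coordinate is either outgoing or incoming,
    so controlling both families controls the state at both ends. *)
Lemma ends_close (p q : R -> 'cV[R]_n) M :
  (forall x, x \in `[0, L] -> `|p x| < c^-1 /\ `|q x| < c^-1) -> 0 <= M ->
  (forall i, `|char_var l i (p (x_out m L i)) - char_var l i (q (x_out m L i))|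
     <= M) ->
  (forall i, `|char_var l i (p (x_in m L i)) - char_var l i (q (x_in m L i))|
     <= M) ->
  `|p 0 - q 0| <= c * M /\ `|p L - q L| <= c * M.
Proof.
move=> small M0 Hout Hin.
have H x : x = 0 \/ x = L -> x \in `[0, L] -> `|p x - q x| <= c * M.
  move=> xe xL; have [ps qs] := small x xL.
  rewrite (le_trans (coords_inv qs ps)) // ler_pM2l //.
  apply: mx_norm_le => // i j; rewrite (ord1 j) mxE [X in _ + X]mxE !char_mxE.
  have := Hout i; have := Hin i; rewrite /x_out /x_in /char_var.
  by case: xe => ->; case: ifP.
by split; apply: H; [left | exact: left_end | right | exact: right_end].
Qed.

Section OneSolution.
Context (H : 'I_n -> R -> R) (H_C1 : forall i, C1_within `[0, T] (H i)).
Context (phi : R -> 'cV[R]_n) (u : R -> R -> 'cV[R]_n).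
Context (u_sol : C1_solution m L T U V B l lambda G H phi u).
Context (u_norm : C1_rect_norm `[0, T] `[0, L] u <= dl).

Lemma solution_le t x : t \in `[0, T] -> x \in `[0, L] ->
  [/\ `|u t x| <= dl, `|dt `[0, T] u t x| <= dl & `|dx `[0, L] u t x| <= dl].
Proof. by case: u_sol => uC1 *; exact: C1_rect_le_norm uC1 u_norm _ _. Qed.

Lemma solution_small t x : t \in `[0, T] -> x \in `[0, L] -> `|u t x| < c^-1.
Proof. by move=> tT xL; have [/le_lt_trans->] := solution_le tT xL. Qed.

Lemma solution_char : sol T L u.
Proof.
move=> t x tT xL; split; first exact: solution_small.
have [uC1 _ pde _ _] := u_sol; have [_ ut ux] := solution_le tT xL.
exists (dt `[0, T] u t x), (dx `[0, L] u t x).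
split; [exact: le_trans dl1 | exact: le_trans dl1 | exact: C1_rect_diff |].
by move=> i; exact: pde.
Qed.

Lemma char_var_small i a : `|a| <= dl -> `|char_var l i a| < c^-1.
Proof.
move=> ad; have ac : `|a| < c^-1 by exact: le_lt_trans dlc.
have zc : `|0 : 'cV[R]_n| < c^-1 by rewrite normr0 invr_gt0.
have := char_var_lipschitz c0 l_lip zc ac (l_le i ac).
rewrite char_var0 !subr0 => /le_lt_trans; apply.
apply: le_lt_trans dlV; rewrite ler_wpM2l // mulr_ge0 ?ler0n // addr_ge0 //.
exact: ltW.
Qed.

Lemma outgoing_small t : t \in `[0, T] -> `|outgoing m L l (u t)| < c^-1.
Proof.
move=> tT; have [->|[i ->]] := cV_norm_attained (outgoing m L l (u t)).
  by rewrite invr_gt0.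
rewrite mxE; apply: char_var_small.
by have [] := solution_le tT (x_out_itv i).
Qed.

(** The C1 norm of an observation is a supremum, hence controls its values and
    increments only once the observation is known to be differentiable with a
    bounded derivative; both follow from the same properties of u. *)
Lemma observation_le i t : t \in `[0, T] ->
  `|observation m L l u i t| <= C1_norm `[0, T] (observation m L l u i) /\
  forall t', t' \in `[0, T] ->
    `|observation m L l u i t' - observation m L l u i t|
      <= C1_norm `[0, T] (observation m L l u i) * `|t' - t|.
Proof.
set ob := observation m L l u i; set x := x_out m L i.
have xL : x \in `[0, L] by exact: x_out_itv.
have [uC1 [uU _] _ _ _] := u_sol; have [du_t _ _ _ _] := uC1.
have dob s : s \in `[0, T] -> derivable_within `[0, T] ob s.
  move=> sT; apply: (derive_within_comp (g := u ^~ x) (p := dt `[0, T] u s x) T0 sT _ _).1.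
    by apply: char_var_differentiable; apply: l_diff; exact: uU.
  by move=> e e0; exact: (derivable_withinE (du_t s x sT xL) e0).
have ulip s s' : s \in `[0, T] -> s' \in `[0, T] ->
    `|u s' x - u s x| <= dl * `|s' - s|.
  move=> sT s'T; apply: (derive_within_lipschitz (f := u ^~ x)) sT s'T => r rT.
    exact: du_t.
  by have [] := solution_le rT xL.
pose K := n%:R * (c + 1) * dl.
have obK s : s \in `[0, T] -> `|derive_within `[0, T] ob s| <= K.
  move=> sT; apply: (derive_within_le T0 sT (dob s sT) ltr01) => s' s'T _.
  have us := solution_small sT xL; have us' := solution_small s'T xL.
  rewrite (le_trans (char_var_lipschitz c0 l_lip us us' (l_le i us'))) //.
  by rewrite -[leRHS]mulrA ler_wpM2l ?ulip // mulr_ge0 ?ler0n ?addr_ge0 ?ltW.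
move=> tT; split; first by have [] := bounded_derivable_le_norm dob obK tT.
move=> t' t'T; apply: (derive_within_lipschitz dob) => // s sT.
by have [] := bounded_derivable_le_norm dob obK sT.
Qed.

Lemma incomingE i t : t \in `[0, T] -> char_var l i (u t (x_in m L i)) =
  G i t (outgoing m L l (u t)) + H i t.
Proof. by case: u_sol => _ _ _ _ bc; exact: bc. Qed.

Lemma initial_valueE x : x \in `[0, L] -> u 0 x = phi x.
Proof. by case: u_sol => _ _ _ ic _; exact: ic. Qed.

Context (M : R) (M0 : 0 <= M).
Context (ob_le : forall i, C1_norm `[0, T] (observation m L l u i) <= M).
Context (H_le : forall i, C1_norm `[0, T] (H i) <= M).

Lemma outgoing_le t : t \in `[0, T] -> `|outgoing m L l (u t)| <= M.
Proof.
move=> tT; apply: mx_norm_le => // i j; rewrite mxE.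
by have [h _] := observation_le i tT; exact: le_trans (ob_le i).
Qed.

(** Comparison with the zero solution: the outgoing coordinates are observed, and
    the incoming ones are given by the boundary condition. *)
Lemma end_values_le t : t \in `[0, T] ->
  `|u t 0| <= c * (c * M + M) /\ `|u t L| <= c * (c * M + M).
Proof.
move=> tT; have cM : 0 <= c * M by rewrite mulr_ge0 // ltW.
have [||i|i|e0 eL] := @ends_close (u t) (fun=> 0) (c * M + M).
- move=> x xL; rewrite normr0 invr_gt0; split=> //; exact: solution_small.
- by rewrite addr_ge0.
- rewrite char_var0 subr0; have [h _] := observation_le i tT.
  by rewrite (le_trans h) // (le_trans (ob_le i)) // lerDr.
- rewrite char_var0 subr0 incomingE // (le_trans (ler_normD _ _)) //.
  apply: lerD; last first.
    by rewrite (le_trans (C1_within_le_norm (H_C1 i) tT).1).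
  have zc : `|0 : 'cV[R]_n| < c^-1 by rewrite normr0 invr_gt0.
  have := G_incr i tT tT zc (outgoing_small tT).
  rewrite G0 // normr0 mul0r !subr0 addr0 => /le_trans; apply.
  by rewrite ler_pM2l // outgoing_le.
- by rewrite !subr0 in e0 eL.
Qed.

(** Comparison with the solution shifted by h in time; the bound is linear in h,
    which yields a bound on the time derivative in the limit. *)
Lemma end_increments_le t h : t \in `[0, T] -> t + h \in `[0, T] -> 0 <= h ->
  `|u (t + h) 0 - u t 0| <= c * ((2 * c + 1) * M * h) /\
  `|u (t + h) L - u t L| <= c * ((2 * c + 1) * M * h).
Proof.
move=> tT thT h0; have Mh : 0 <= M * h by rewrite mulr_ge0.
have cMh : 0 <= c * (M * h) by rewrite mulr_ge0 // ltW.
have thE : t + h - t = h by rewrite addrAC subrr add0r.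
have out_incr i : `|observation m L l u i (t + h) - observation m L l u i t|
    <= M * h.
  have [_ /(_ _ thT)] := observation_le i tT; rewrite thE (ger0_norm h0).
  by move=> /le_trans; apply; rewrite ler_wpM2r.
have XE : (2 * c + 1) * M * h = c * (M * h) + c * (M * h) + M * h by ring.
apply: ends_close.
- by move=> x xL; split; exact: solution_small.
- by rewrite XE; lra.
- by move=> i; rewrite (le_trans (out_incr i)) // XE; lra.
- move=> i; rewrite !incomingE //.
  set A := G i (t + h) _; set A' := G i t _.
  have -> : A + H i (t + h) - (A' + H i t) = (A - A') + (H i (t + h) - H i t).
    by rewrite opprD addrACA.
  rewrite XE (le_trans (ler_normD _ _)) // lerD //; last first.
    have [dH _] := H_C1 i.
    have := @derive_within_lipschitz _ _ 0 T (H i) t (t + h) _ dH _ tT thT.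
    move=> /(_ M) HL; rewrite (le_trans (HL _)) ?thE ?(ger0_norm h0) // => s sT.
    by rewrite (le_trans (C1_within_le_norm (H_C1 i) sT).2).
  have := G_incr i tT thT (outgoing_small tT) (outgoing_small thT).
  rewrite thE (ger0_norm h0) => /le_trans; apply; rewrite -mulrDr ler_pM2l //.
  apply: lerD; last by rewrite ler_wpM2r // outgoing_le.
  apply: mx_norm_le => // j k; rewrite mxE [X in _ + X]mxE !mxE.
  exact: out_incr.
Qed.

End OneSolution.

Let estimate_from_ends := backward_estimate c0 l_lip lambda_lip f_lip l_le
  lambda_le mu0 lambda_ge char_mx_inv L0 (ltW T0).

(** The values of u(0, x) are estimated by comparing u with 0, and u_t(0, x) by
    comparing u with its time shifts. The system then gives u_x(0, x), because
    the speeds lambda_i do not vanish. *)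
Lemma initial_data_estimate : exists2 C, 0 < C & forall H phi u M,
  (forall i, C1_within `[0, T] (H i)) ->
  C1_solution m L T U V B l lambda G H phi u ->
  C1_rect_norm `[0, T] `[0, L] u <= dl -> 0 <= M ->
  (forall i, C1_norm `[0, T] (observation m L l u i) <= M) ->
  (forall i, C1_norm `[0, T] (H i) <= M) ->
  C1_norm `[0, L] phi <= C * M.
Proof.
have [C C0 CP] := estimate_from_ends.
pose K0 := C * (c * (c + 1)); pose K1 := C * (c * (2 * c + 1)).
pose K2 := c * (mu * (c * K0 + n%:R * c * K1)).
have n0 : 0 <= n%:R :> R by exact: ler0n.
have K00 : 0 < K0 by rewrite !mulr_gt0 // addr_gt0.
have K10 : 0 < K1 by rewrite !mulr_gt0 // addr_gt0 // mulr_gt0.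
have cK0 : 0 <= c * K0 by rewrite mulr_ge0 ?(ltW K00) ?(ltW c0).
have cK1 : 0 <= n%:R * c * K1.
  by rewrite mulr_ge0 ?(ltW K10) // mulr_ge0 // (ltW c0).
have K20' : 0 <= mu * (c * K0 + n%:R * c * K1).
  by rewrite mulr_ge0 ?(ltW mu0) // addr_ge0.
have K20 : 0 <= K2 by rewrite mulr_ge0 ?(ltW c0).
exists (K0 + K2); first by rewrite ltr_wpDr.
move=> H phi u M H_C1 usol un M0 obM HM.
have uchar := solution_char usol un.
have TT : 0 \in `[0, T] by rewrite in_itv/= lexx ltW.
have u0 x : x \in `[0, L] -> `|u 0 x| <= K0 * M.
  move=> xL.
  have := CP T u (fun _ _ => 0) (c * (c * M + M)) uchar
    (char_solution0 l lambda c0 f0) _ (ltW muLT) (lexx T) _ x xL.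
  rewrite subr0 => H1; apply: (le_trans (H1 _ _)).
  - by rewrite !mulr_ge0 ?addr_ge0 ?mulr_ge0 // ltW.
  - by move=> t tT; rewrite !subr0; exact: (end_values_le H_C1 usol un).
  - by rewrite le_eqVlt; apply/orP; left; apply/eqP; rewrite /K0; ring.
have [uC1 _ pde _ _] := usol; have [du_t du_x _ _ _] := uC1.
have ut x : x \in `[0, L] -> `|dt `[0, T] u 0 x| <= K1 * M.
  move=> xL; have r0 : 0 < T - mu * L by rewrite subr_gt0.
  (* The shift h must leave a time interval of length T - h >= mu * L. *)
  apply: (derive_within_le T0 TT (du_t 0 x TT xL) r0) => h hT.
  rewrite sub0r normrN subr0 => hr.
  move: (hT); rewrite in_itv/= => /andP[h0 hT'].
  rewrite ger0_norm // in hr *.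
  have ush := char_solution_shift h0 uchar.
  have TTh : T - h <= T by lra.
  have ures := char_solution_restrict TTh uchar.
  have := CP (T - h) _ u (c * ((2 * c + 1) * M * h)) ush ures _ _ TTh _ x xL.
  rewrite /= add0r => H1; apply: (le_trans (H1 _ _ _)).
  - by rewrite !mulr_ge0 ?addr_ge0 ?mulr_ge0 // ltW.
  - lra.
  - move=> t; rewrite in_itv/= => /andP[t0 tTh].
    apply: (end_increments_le H_C1 usol un) => //.
      by rewrite in_itv/=; apply/andP; split; lra.
    by rewrite in_itv/=; apply/andP; split; lra.
  - by rewrite le_eqVlt; apply/orP; left; apply/eqP; rewrite /K1; ring.
have ux x : x \in `[0, L] -> `|dx `[0, L] u 0 x| <= K2 * M.
  move=> xL; have usm := solution_small usol un TT xL.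
  rewrite (le_trans (char_mx_inv _ usm)) // -mulrA ler_pM2l //.
  apply: mx_norm_le => [|i j].
    by rewrite mulr_ge0.
  rewrite (ord1 j) char_mxE -mulrA.
  set X := pairing _ _.
  have := pde i 0 x TT xL; rewrite -/(pairing _ _) pairingDr pairingZr -/X => pdeX.
  (* The factor mu * |lambda_i| >= 1 makes the equation for lambda_i * X usable. *)
  apply: (@le_trans _ _ (mu * `|lambda i (u 0 x)| * `|X|)).
    by rewrite ler_peMl // lambda_ge.
  rewrite -mulrA ler_pM2l // -normrM.
  have -> : lambda i (u 0 x) * X =
      source B l i (u 0 x) - pairing (l i (u 0 x)) (dt `[0, T] u 0 x).
    by rewrite -pdeX addrAC subrr add0r.
  rewrite (le_trans (ler_normB _ _)) // mulrDl lerD //.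
    have zc : `|0 : 'cV[R]_n| < c^-1 by rewrite normr0 invr_gt0.
    have := f_lip i zc usm; rewrite f0 !subr0 => /le_trans; apply.
    by rewrite -mulrA ler_pM2l // u0.
  rewrite -[leRHS]mulrA; apply: pairing_bound; first exact: l_le.
  exact: ut.
have phiE x : x \in `[0, L] -> u 0 x = phi x by exact: (initial_valueE usol).
rewrite /C1_norm mulrDl lerD //; apply: sup_norm_le.
- by exists 0; exact: left_end.
- by move=> x xL; rewrite -phiE // u0.
- by exists 0; exact: left_end.
move=> x xL.
have [_ ->] : derivable_within `[0, L] phi x /\
    derive_within `[0, L] phi x = dx `[0, L] u 0 x.
  apply: derive_within_unique => // e e0.
  have [d d0 dP] := derivable_withinE (du_x 0 x TT xL) e0.
  by exists d => // y yL xy; rewrite -!phiE //; exact: dP.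
exact: ux.
Qed.

(** Equal observations and equal H_i give equal values at both ends, so that the
    difference estimate applies with boundary bound 0. *)
Lemma initial_data_unique H phi1 phi2 u1 u2 :
  C1_solution m L T U V B l lambda G H phi1 u1 ->
  C1_solution m L T U V B l lambda G H phi2 u2 ->
  C1_rect_norm `[0, T] `[0, L] u1 <= dl ->
  C1_rect_norm `[0, T] `[0, L] u2 <= dl ->
  (forall i t, t \in `[0, T] ->
     observation m L l u1 i t = observation m L l u2 i t) ->
  forall x, x \in `[0, L] -> phi1 x = phi2 x.
Proof.
move=> s1 s2 n1 n2 ob12 x xL; have [C C0 CP] := estimate_from_ends.
rewrite -(initial_valueE s1) // -(initial_valueE s2) //.
apply/eqP; rewrite -subr_eq0 -normr_le0 -[leRHS](mulr0 C).
apply: (CP T u1 u2 0 (solution_char s1 n1) (solution_char s2 n2)) => //.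
  exact: ltW.
move=> t tT.
suff : `|u1 t 0 - u2 t 0| <= c * 0 /\ `|u1 t L - u2 t L| <= c * 0.
  by rewrite mulr0.
apply: ends_close => //.
- by move=> y yL; split; [exact: (solution_small s1)|exact: (solution_small s2)].
- move=> i; have := ob12 i t tT; rewrite /observation => ->.
  by rewrite subrr normr0.
- move=> i; rewrite (incomingE s1) // (incomingE s2) //.
  have -> : outgoing m L l (u1 t) = outgoing m L l (u2 t).
    by apply/colP => j; rewrite !mxE; exact: ob12.
  by rewrite subrr normr0.
Qed.

End Observability.

(** * The observability theorem *)

Lemma ler_sum_single (R : realType) (n : nat) (P : pred 'I_n) (F : 'I_n -> R) i :
  P i -> (forall j, 0 <= F j) -> F i <= \sum_(j < n | P j) F j.
Proof. by move=> Pi F0; rewrite (bigD1 i) //= lerDl sumr_ge0. Qed.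

(** The strict inequality on T leaves room for a slope mu that is larger than
    every 1 / |lambda_i(0)|, hence than every 1 / |lambda_i(u)| for small u. *)
Lemma admissible_slope (R : realType) (n : nat) (a : 'I_n -> R) (L T : R) :
  0 < L -> (forall i, a i != 0) ->
  L * \big[Num.max/0]_(i < n) `|a i|^-1 < T ->
  exists2 mu : R, 0 < mu & mu * L < T /\ forall i, 1 < mu * `|a i|.
Proof.
move=> L0 a0; set mx := \big[Num.max/0]_(i < n) _ => LT.
have mx0 : 0 <= mx by exact: bigmax_ge_id.
have mxT : mx < T / L by rewrite ltr_pdivlMr // mulrC.
pose mu : R := (mx + T / L) / 2.
have mxmu : mx < mu by rewrite /mu; lra.
have muT : mu < T / L by rewrite /mu; lra.
exists mu; first exact: le_lt_trans mxmu.
split=> [|i]; first by rewrite -ltr_pdivlMr.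
have ai : 0 < `|a i| by rewrite normr_gt0.
rewrite -ltr_pdivrMr // div1r (le_lt_trans _ mxmu) //.
exact: (le_bigmax 0 (fun i => `|a i|^-1)).
Qed.

Theorem theorem3p2 (R : realType) (n m : nat) (n_gt0 : (0 < n)%N)
  (m_le_n : (m <= n)%N) (L T : R) (L_gt0 : 0 < L)
  (U V : set 'cV[R]_n)
  (A : 'cV[R]_n -> 'M[R]_n) (B : 'cV[R]_n -> 'cV[R]_n)
  (l : 'I_n -> 'cV[R]_n -> 'rV[R]_n) (lambda : 'I_n -> 'cV[R]_n -> R)
  (G : 'I_n -> R -> 'cV[R]_n -> R)
  (U_open : open U) (U0 : U 0) (V_open : open V) (V0 : V 0)
  (hypA : hyperbolic U A l lambda) (B0 : B 0 = 0)
  (l_C1 : forall i, C1_open U (l i))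
  (lambda_C1 : forall i, C1_open U (lambda i))
  (f_C1 : forall i, C1_open U (source B l i))
  (G_C1 : forall i, C1_time_open `[0, T] V (G i))
  (Gt_lip : forall i, locally_lipschitz_snd `[0, T] V
     (fun t v => derive_within `[0, T] (G i ^~ v) t))
  (f0 : forall i, source B l i 0 = 0)
  (lambda_neg : forall r : 'I_n, (r < m)%N -> forall a, U a -> lambda r a < 0)
  (lambda_pos : forall s : 'I_n, (m <= s)%N -> forall a, U a -> 0 < lambda s a)
  (G0 : forall i t, t \in `[0, T] -> G i t 0 = 0)
  (T_large : L * \big[Num.max/0]_(i < n) `|lambda i 0|^-1 < T) :
  exists eps delta C : R,
  [/\ 0 < eps, 0 < delta, 0 < C,
      forall H phi u,
        admissible_data m L T A B l G eps H phi ->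
        C1_solution m L T U V B l lambda G H phi u ->
        C1_rect_norm `[0, T] `[0, L] u <= delta ->
        C1_norm `[0, L] phi <=
        C * (\sum_(r < n | (r < m)%N) C1_norm `[0, T] (observation m L l u r)
           + \sum_(s < n | (m <= s)%N) C1_norm `[0, T] (observation m L l u s)
           + \sum_(i < n) C1_norm `[0, T] (H i)) &
      forall H phi1 phi2 u1 u2,
        admissible_data m L T A B l G eps H phi1 ->
        admissible_data m L T A B l G eps H phi2 ->
        C1_solution m L T U V B l lambda G H phi1 u1 ->
        C1_solution m L T U V B l lambda G H phi2 u2 ->
        C1_rect_norm `[0, T] `[0, L] u1 <= delta ->
        C1_rect_norm `[0, T] `[0, L] u2 <= delta ->
        (forall i t, t \in `[0, T] ->
           observation m L l u1 i t = observation m L l u2 i t) ->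
        forall x, x \in `[0, L] -> phi1 x = phi2 x].
Proof.
have T0 : 0 < T.
  by rewrite (le_lt_trans _ T_large) // mulr_ge0 ?(ltW L_gt0) // bigmax_ge_id.
have lam0 i : lambda i 0 != 0.
  have [im|mi] := ltnP i m; first by rewrite lt_eqF // lambda_neg.
  by rewrite gt_eqF // lambda_pos.
have [mu mu0 [muLT mulam]] := admissible_slope L_gt0 lam0 T_large.
have l_diff i a : U a -> differentiable (l i) a by have [dl _] := l_C1 i; exact: dl.
have l_free : row_free (char_mx l 0) by have [] := hypA 0 U0.
have [k k0 k_lip] := near_pinfty_ex (C1_family_lipschitz U_open U0 l_C1).
have G_near i : \forall c \near +oo, forall t t' a b, t \in `[0, T] ->
    t' \in `[0, T] -> `|a| < c^-1 -> `|b| < c^-1 ->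
    `|G i t' b - G i t a| <= c * (`|b - a| + `|a| * `|t' - t|).
  have [d d0 dP] := boundary_increment T0 V_open V0 (G_C1 i) (Gt_lip i) (G0 i).
  near=> c; move=> t t' a b tT t'T ac bc.
  have dc : d <= c by near: c; apply: nbhs_pinfty_ge; rewrite num_real.
  have := dP t t' a b tT t'T (lt_inv_le d0 dc ac) (lt_inv_le d0 dc bc).
  rewrite -mulrA -mulrDr => /le_trans; apply.
  by rewrite ler_wpM2r // addr_ge0 // mulr_ge0.
have [c [[c0 l_lip lambda_lip f_lip] [l_le lambda_le lambda_ge]
    [inv_mx inv_v G_incr]]] : exists c : R,
  [/\ [/\ 0 < c,
      forall i a b, `|a| < c^-1 -> `|b| < c^-1 -> `|l i b - l i a| <= c * `|b - a|,
      forall i a b, `|a| < c^-1 -> `|b| < c^-1 ->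
        `|lambda i b - lambda i a| <= c * `|b - a| &
      forall i a b, `|a| < c^-1 -> `|b| < c^-1 ->
        `|source B l i b - source B l i a| <= c * `|b - a|],
   [/\ forall i a, `|a| < c^-1 -> `|l i a| <= c,
      forall i a, `|a| < c^-1 -> `|lambda i a| <= c &
      forall i a, `|a| < c^-1 -> 1 <= mu * `|lambda i a|] &
   [/\ forall a w : 'cV[R]_n, `|a| < c^-1 -> `|w| <= c * `|char_mx l a *m w|,
      forall a b : 'cV[R]_n, `|a| < c^-1 -> `|b| < c^-1 ->
        `|b - a| <= c * `|char_mx l b *m b - char_mx l a *m a| &
      forall i t t' a b, t \in `[0, T] -> t' \in `[0, T] ->
        `|a| < c^-1 -> `|b| < c^-1 ->
        `|G i t' b - G i t a| <= c * (`|b - a| + `|a| * `|t' - t|)]].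
  apply: (@filter_ex _ (+oo : set_system R)).
  near=> c; split; split.
  - by near: c; apply: nbhs_pinfty_gt; rewrite num_real.
  - by near: c; exact: C1_family_lipschitz l_C1.
  - by near: c; exact: C1_family_lipschitz lambda_C1.
  - by near: c; exact: C1_family_lipschitz f_C1.
  - by near: c; exact: C1_family_bounded l_C1.
  - by near: c; exact: C1_family_bounded lambda_C1.
  - by near: c; exact: C1_family_lower_bound lambda_C1 mulam.
  - by near: c; exact: (char_mx_coercive k0 k_lip l_free).
  - by near: c; exact: (char_coords_coercive k0 k_lip l_free).
  - by move=> i; move: i; near: c; exact: filter_forall.
have nc : 0 <= n%:R * (c + 1) by rewrite mulr_ge0 ?ler0n // addr_ge0 // ltW.
pose dl : R := Num.min 1 (c^-1 / (n%:R * (c + 1) + 2)).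
have X0 : 0 < n%:R * (c + 1) + 2 by rewrite ltr_wpDl.
have ci : 0 < c^-1 by rewrite invr_gt0.
have dl0 : 0 < dl by rewrite lt_min ltr01 divr_gt0.
have dl1 : dl <= 1 by rewrite ge_min lexx.
have dlX : dl * (n%:R * (c + 1) + 2) <= c^-1.
  by rewrite -ler_pdivlMr // ge_min lexx orbT.
have dlnc : 0 <= dl * (n%:R * (c + 1)) by rewrite mulr_ge0 // ltW.
have dlc : dl < c^-1 by rewrite mulrDr in dlX; lra.
have dlV : n%:R * (c + 1) * dl < c^-1 by rewrite mulrC; rewrite mulrDr in dlX; lra.
have [C C0 CP] := initial_data_estimate (m := m) V L_gt0 mu0 muLT c0
  dl1 dlc dlV l_lip lambda_lip f_lip l_le lambda_le lambda_ge inv_mx inv_v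
  G_incr l_diff f0 G0.
exists 1, dl, C; split=> //.
  move=> H phi u [_ H_C1 _ _ _] usol un.
  set S1 := \sum_(r < n | _) _; set S2 := \sum_(s < n | _) _.
  set S3 := \sum_(i < n) _.
  have S10 : 0 <= S1 by apply: sumr_ge0 => i _; exact: C1_norm_ge0.
  have S20 : 0 <= S2 by apply: sumr_ge0 => i _; exact: C1_norm_ge0.
  have S30 : 0 <= S3 by apply: sumr_ge0 => i _; exact: C1_norm_ge0.
  apply: CP usol un _ _ _ => //; first by rewrite !addr_ge0.
    move=> i; have [im|mi] := ltnP i m.
      have : C1_norm `[0, T] (observation m L l u i) <= S1.
        by apply: (ler_sum_single im) => j; exact: C1_norm_ge0.
      lra.
    have : C1_norm `[0, T] (observation m L l u i) <= S2.
      by apply: (ler_sum_single mi) => j; exact: C1_norm_ge0.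
    lra.
  move=> i; have : C1_norm `[0, T] (H i) <= S3.
    by apply: ler_sum_single => // j; exact: C1_norm_ge0.
  lra.
move=> H phi1 phi2 u1 u2 _ _.
exact: (initial_data_unique L_gt0 mu0 muLT c0 dl1 dlc l_lip lambda_lip f_lip l_le
  lambda_le lambda_ge inv_mx inv_v).
Unshelve. all: by end_near. Qed.
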